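(* Let $\mathbb{D}\in\mathbb{R}^{M\times M}$ satisfy $\mathbb{D}+\mathbb{D}^T=0$, $r\ge1$, $\gamma\in(0,1)$, and assume $\tau\|\mathbb{D}\|_{\ell_2}\le\lambda(r,\gamma)$. Let $\mathbf{R}\in [H^{\ell}(0,T)]^M$ for some integer $\ell\ge 1$, and let $\mathbf{Y}\in [H^{\ell+1}(0,T)]^M$ be the exact solution of $\mathbf{Y}'=\mathbb{D}\mathbf{Y}+\mathbf{R}$ on $(0,T)$, $\mathbf{Y}(0)=\mathbf{Y}^0$. Let $\widetilde{\mathbf{Y}}_r$ be the output of the explicit time discretization described in the context. Then \[ \max_{0\le t\le T}\|\mathbf{Y}(t)-\widetilde{\mathbf{Y}}_r(t)\|_{\ell_2}\leq CT^{\frac 12}\frac{\tau^{\min(r,\ell)}}{r^{\ell}}\left(\|\mathbf{Y}\|_{H^{\ell+1}(0,T;\ell_2)}+\|\mathbf{R}\|_{H^{\ell}(0,T;\ell_2)}\right), \] where the constant $C$ is independent of $\tau$ and $r$.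
   Context: Let $0=t_0<t_1<\cdots<t_N=T$, $\tau_n=t_{n+1}-t_n$, $\tau=\max_n\tau_n$; $P^m$ denotes real polynomials of degree $\le m$; $\|\cdot\|_{\ell_2}$ is the Euclidean norm and induced matrix norm. $I_{r-1}\mathbf{R}$ denotes, on each $(t_n,t_{n+1})$, the $L^2(t_n,t_{n+1})$-orthogonal projection of $\mathbf{R}$ onto $[P^{r-1}]^M$. For $1\le m\le r$, $\gamma_m^r=0$ if $r\equiv0,3\pmod4$ and $\gamma_m^r=\frac{(m+1)(m-1+\gamma)}{m(m+\gamma)}$ if $r\equiv1,2\pmod4$. Scheme: $\widetilde{\mathbf{Y}}_r$ is continuous on $[0,T]$, polynomial of degree $\le\max(2r-1,r+1)$ on each $[t_n,t_{n+1}]$, $\widetilde{\mathbf{Y}}_r(0)=\mathbf{Y}^0$, computed interval by interval with $\mathbf{Y}^n=\widetilde{\mathbf{Y}}_r(t_n)$: (1) $\mathbf{Y}_0\equiv\mathbf{Y}^n$, $\widetilde{\mathbf{Y}}_0\in[P^1]^M$ with $\widetilde{\mathbf{Y}}_0'=\frac1\gamma\mathbb{D}\mathbf{Y}^n$, $\widetilde{\mathbf{Y}}_0(t_n)=\mathbf{Y}^n$; (2) for $1\le m\le r$, $\mathbf{Y}_m\in[P^{m+r-1}]^M$, $\mathbf{Y}_m'=\mathbb{D}\mathbf{Y}_{m-1}+I_{r-1}\mathbf{R}$, $\mathbf{Y}_m(t_n)=\mathbf{Y}^n$; (3) for $1\le m\le r$, $\widetilde{\mathbf{Y}}_m\in[P^{\max(m+r-1,m+1)}]^M$,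 $\widetilde{\mathbf{Y}}_m'=\mathbb{D}[\gamma_m^r\widetilde{\mathbf{Y}}_{m-1}+(1-\gamma_m^r)\mathbf{Y}_{m-1}]+I_{r-1}\mathbf{R}$, $\widetilde{\mathbf{Y}}_m(t_n)=\mathbf{Y}^n$; and $\widetilde{\mathbf{Y}}_r|_{[t_n,t_{n+1}]}$ is $\widetilde{\mathbf{Y}}_r$ from step (3). CFL bounds: $\lambda(r,\gamma)=\sqrt6$ if $r\equiv0\pmod4$; $\lambda(1,\gamma)=\sqrt{(1-\gamma^2)/2}$, $\lambda(r,\gamma)=\sqrt{2(1-\gamma)/(3-\gamma)}$ if $r\equiv1\pmod 4$, $r\ge5$; $\lambda(2,\gamma)=\sqrt{2(4-\gamma^2)/3}$, $\lambda(r,\gamma)=\sqrt{6(2-\gamma)/(4-\gamma)}$ if $r\equiv2\pmod4$, $r\ge6$; $\lambda(r,\gamma)=\sqrt2$ if $r\equiv3\pmod4$. *)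

(* Defs.v *)
From HB Require Import structures.
From mathcomp Require Import all_boot all_order all_algebra.
From mathcomp Require Import all_classical all_reals all_analysis.
Set Implicit Arguments. Unset Strict Implicit. Unset Printing Implicit Defensive.
Import Order.TTheory GRing.Theory Num.Theory.
Import numFieldNormedType.Exports.
Local Open Scope classical_set_scope.
Local Open Scope ring_scope.

Section Defs.
Variable R : realType.
Variable M : nat.

Notation mu := (@lebesgue_measure R).

Definition Icc (a b : R) : set R := `[a, b]%classic.

Definition enorm (v : 'cV[R]_M) : R := Num.sqrt (\sum_(i < M) v i 0 ^+ 2).

Definition opnorm (A : 'M[R]_M) : R :=
  sup [set enorm (A *m x) | x in [set x : 'cV[R]_M | enorm x = 1]].

(* G is a chain of (weak) derivatives witnessing f in [H^k(0,T)]^M: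
   G 0 = f on [0,T]; for j < k, G j is absolutely continuous on [0,T]
   with derivative G (j+1) (integral representation); G k in L^2(0,T). *)
Definition Hchain (k : nat) (T : R) (f : R -> 'cV[R]_M)
    (G : nat -> R -> 'cV[R]_M) : Prop :=
  (forall t, 0 <= t <= T -> G 0%N t = f t) /\
  (forall (j : nat) (i : 'I_M), (j < k)%N ->
     mu.-integrable (Icc 0 T) (fun x => (G j.+1 x i 0)%:E) /\
     forall t, 0 <= t <= T ->
       G j t i 0 = G j 0 i 0 + Rintegral mu (Icc 0 t) (fun x => G j.+1 x i 0)) /\
  (forall i : 'I_M,
     measurable_fun (Icc 0 T) (fun x => G k x i 0) /\
     (\int[mu]_(x in (Icc 0 T)) ((G k x i 0) ^+ 2)%:E < +oo)%E).

Definition Hnorm (k : nat) (T : R) (G : nat -> R -> 'cV[R]_M) : R :=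
  Num.sqrt (\sum_(j < k.+1)
     fine (\int[mu]_(x in (Icc 0 T)) ((enorm (G j x)) ^+ 2)%:E)%E).

Definition vpoly := 'I_M -> {poly R}.
Definition vpeval (P : vpoly) (t : R) : 'cV[R]_M := \col_i (P i).[t].
Definition vpderiv (P : vpoly) : vpoly := fun i => (P i)^`().
Definition vpmul (A : 'M[R]_M) (P : vpoly) : vpoly :=
  fun i => \sum_(k < M) (A i k)%:P * P k.
Definition vpadd (P Q : vpoly) : vpoly := fun i => P i + Q i.
Definition vpscale (c : R) (P : vpoly) : vpoly := fun i => c *: P i.
Definition vpconst (v : 'cV[R]_M) : vpoly := fun i => (v i 0)%:P.
Definition vpdeg_le (m : nat) (P : vpoly) : Prop := forall i, (size (P i) <= m.+1)%N.

Definition is_L2proj (r : nat) (a b : R) (f : R -> 'cV[R]_M) (P : vpoly) : Prop :=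
  vpdeg_le r.-1 P /\
  forall (i : 'I_M) (q : {poly R}), (size q <= r)%N ->
    Rintegral mu (Icc a b) (fun s => (f s i 0 - (P i).[s]) * q.[s]) = 0.

Definition gam (r : nat) (g : R) (m : nat) : R :=
  if (r %% 4 == 0)%N || (r %% 4 == 3)%N then 0
  else ((m%:R + 1) * (m%:R - 1 + g)) / (m%:R * (m%:R + g)).

Definition lam (r : nat) (g : R) : R :=
  if (r %% 4 == 0)%N then Num.sqrt 6
  else if (r %% 4 == 1)%N then
    (if r == 1%N then Num.sqrt ((1 - g ^+ 2) / 2)
     else Num.sqrt (2 * (1 - g) / (3 - g)))
  else if (r %% 4 == 2)%N then
    (if r == 2%N then Num.sqrt (2 * (4 - g ^+ 2) / 3)
     else Num.sqrt (6 * (2 - g) / (4 - g)))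
  else Num.sqrt 2.

Definition scheme_step (D : 'M[R]_M) (r : nat) (g : R) (f : R -> 'cV[R]_M)
    (a b : R) (Yn : 'cV[R]_M) (Ytr : vpoly) : Prop :=
  exists (IR : vpoly) (Y Yt : nat -> vpoly),
    is_L2proj r a b f IR /\
    Y 0%N = vpconst Yn /\
    vpdeg_le 1 (Yt 0%N) /\
    vpderiv (Yt 0%N) = vpscale g^-1 (vpmul D (vpconst Yn)) /\
    vpeval (Yt 0%N) a = Yn /\
    (forall m : nat, (1 <= m <= r)%N ->
       vpdeg_le (m + r - 1) (Y m) /\
       vpderiv (Y m) = vpadd (vpmul D (Y m.-1)) IR /\
       vpeval (Y m) a = Yn /\
       vpdeg_le (maxn (m + r - 1) m.+1) (Yt m) /\
       vpderiv (Yt m) =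
         vpadd (vpmul D (vpadd (vpscale (gam r g m) (Yt m.-1))
                               (vpscale (1 - gam r g m) (Y m.-1)))) IR /\
       vpeval (Yt m) a = Yn) /\
    Ytr = Yt r.

Definition scheme_output (D : 'M[R]_M) (r : nat) (g : R) (f : R -> 'cV[R]_M)
    (N : nat) (t : nat -> R) (Y0 : 'cV[R]_M) (Ytil : R -> 'cV[R]_M) : Prop :=
  Ytil 0 = Y0 /\
  forall n : nat, (n < N)%N ->
    exists Ytr : vpoly,
      scheme_step D r g f (t n) (t n.+1) (Ytil (t n)) Ytr /\
      forall s, t n <= s <= t n.+1 -> Ytil s = vpeval Ytr s.

End Defs.

(* Main.v *)
Require Import Defs.
From HB Require Import structures.
From mathcomp Require Import all_boot all_order all_algebra.
From mathcomp Require Import all_classical all_reals all_analysis.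
From mathcomp Require Import measurable_realfun zify ring lra.

(** A one-step comparison with the exact solution on each [t_n, t_(n+1)].
    The scheme started from the exact value [Y(t_n)] is a Picard iteration, so
    its error solves [eps_m' = D eps_(m-1) + (R - I_(r-1) R)]; it is bounded by
    [(|D| h)^r / r!] times [Y - Y(t_n)] plus [e^(|D| h)] times the primitive of
    [R - I_(r-1) R].  An error [e] in the initial value is multiplied by
    [P(s D)], with [P(z) = sum_(k <= r) z^k / k! + c z^(r+1) / (r+1)!], where
    the product of the [gamma_m^r] telescopes to [c = (r+1) / (r+gamma)].
    Skew-symmetry gives [<u, D u> = 0], so the derivative in [s] of
    [|P(s D) v|^2] is an alternating sum in the numbers [|D^n v|^2], negative
    under the CFL condition: [P(s D)] is a contraction, and the local errors
    simply add up (by Cauchy-Schwarz, whence the factor [T^(1/2)]).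

    The factor [1 / r^l] comes from the projection error.  One derivative is
    traded for a factor [h / r] by Bessel's inequality for the derivatives of
    the Legendre polynomials, orthogonal for the weight [(x - a)(b - x)]. *)

Set Implicit Arguments.
Unset Strict Implicit.
Unset Printing Implicit Defensive.
Import Order.TTheory GRing.Theory Num.Theory.
Import numFieldNormedType.Exports.
Local Open Scope classical_set_scope.
Local Open Scope ring_scope.

(** One obstacle is regularity: the projection estimate acts on Sobolev functions, which need not
    have pointwise derivatives. Such a function is carried with its [L2] derivative ([AC]), and
    integration by parts against a polynomial [Q] is proved by showing that the defect has
    increments of order [3/2], hence is constant. Bessel's inequality bounds only finite Legendre
    sums; density of polynomials (Bernstein) then gives the whole projection error.

    Another obstacle is uniformity in [r]. Since [lam r g <= 3], the CFL condition also bounds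
    [|D| h] independently of [r], and [r!] then absorbs both a geometric factor and [r^l]. Each
    derivative traded in the projection error costs one degree, so at most [min(r, l)] are traded.

    The sign of the leading term of [<P(s D) v, D^(r+1) v>] depends on [r mod 4]. It is favourable
    for [r = 0, 3], where [c = 0]; for [r = 1, 2] it is not, and the scheme compensates with
    [c > 1]. Comparing the first terms of the alternating sums yields exactly the bounds in [lam].

    A step contributes [sqrt (h W)] times the rate, with [W] a squared norm on that step alone, so
    summation loses no power of [tau]. *)

Section SquareIntegrable.
Context {R : realType}.
Notation mu := (@lebesgue_measure R).
Implicit Types (a b c : R) (f g : R -> R).

(** * Square-integrable functions on a compact interval *)

Definition integ a b f : R := Rintegral mu (Icc a b) f.

Definition L1 a b f : Prop := mu.-integrable (Icc a b) (EFin \o f).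

Definition L2 a b f : Prop :=
  measurable_fun (Icc a b) f /\ L1 a b (fun x => f x ^+ 2).

Lemma measurable_Icc a b : measurable (Icc a b : set (measurableTypeR R)).
Proof. exact: measurable_itv. Qed.
Hint Resolve measurable_Icc : core.

Lemma mem_Icc a b x : Icc a b x <-> a <= x <= b.
Proof. by rewrite /Icc /= in_itv. Qed.

Lemma continuous_L1 a b f : {within Icc a b, continuous f} -> L1 a b f.
Proof. by apply: continuous_compact_integrable; exact: segment_compact. Qed.

Lemma L1_cst a b k : L1 a b (fun=> k).
Proof. by apply/continuous_L1/continuous_subspaceT => x; exact: cvg_cst. Qed.

Lemma L1D a b f g : L1 a b f -> L1 a b g -> L1 a b (fun x => f x + g x).
Proof. by move=> lf lg; exact: (integrableD (measurable_Icc a b) lf lg). Qed.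

Lemma L1Z a b k f : L1 a b f -> L1 a b (fun x => k * f x).
Proof. by move=> lf; exact: (integrableZl (measurable_Icc a b) k lf). Qed.

Lemma L1N a b f : L1 a b f -> L1 a b (fun x => - f x).
Proof.
move=> /(@L1Z _ _ (-1)); congr (L1 _ _ _).
by apply/funext => x; rewrite mulN1r.
Qed.

Lemma L1B a b f g : L1 a b f -> L1 a b g -> L1 a b (fun x => f x - g x).
Proof. by move=> lf /L1N; exact: L1D. Qed.

Lemma L1_norm a b f : L1 a b f -> L1 a b (fun x => `|f x|).
Proof. exact: integrable_norm. Qed.

Lemma L1_sum a b (I : Type) (s : seq I) (F : I -> R -> R) :
  (forall i, L1 a b (F i)) -> L1 a b (fun x => \sum_(i <- s) F i x).
Proof.
move=> lF; elim: s => [|i s IH].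
  by under eq_fun do rewrite big_nil; exact: L1_cst.
by under eq_fun do rewrite big_cons; exact: L1D.
Qed.

Lemma L1_measurable a b f : L1 a b f -> measurable_fun (Icc a b) f.
Proof. by move=> /integrableP[/measurable_EFinP]. Qed.

Lemma L1_le a b f g : measurable_fun (Icc a b) f -> L1 a b g ->
  (forall x, a <= x <= b -> `|f x| <= g x) -> L1 a b f.
Proof.
move=> mf lg fg; apply: (le_integrable _ _ _ lg) => //.
  exact/measurable_EFinP.
move=> x /mem_Icc abx /=; rewrite lee_fin (le_trans (fg x abx))//.
exact: ler_norm.
Qed.

Lemma L1_eq a b f g : (forall x, a <= x <= b -> f x = g x) ->
  L1 a b f -> L1 a b g.
Proof.
move=> fg; apply: eq_integrable => // x; rewrite inE => /mem_Icc abx /=.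
by rewrite fg.
Qed.

Lemma sub_Icc a b a' b' : a <= a' -> b' <= b -> Icc a' b' `<=` Icc a b.
Proof.
move=> aa bb x /mem_Icc /andP[a'x xb']; apply/mem_Icc.
by rewrite (le_trans aa a'x) (le_trans xb' bb).
Qed.

Lemma L1_sub a b a' b' f : a <= a' -> b' <= b -> L1 a b f -> L1 a' b' f.
Proof.
move=> aa bb; apply: integrableS => //.
exact: sub_Icc.
Qed.

Lemma within_continuousM a b f g : {within Icc a b, continuous f} ->
  {within Icc a b, continuous g} ->
  {within Icc a b, continuous (fun x => f x * g x)}.
Proof. by move=> cf cg x; apply: cvgM; [exact: cf|exact: cg]. Qed.

Lemma continuous_L2 a b f : {within Icc a b, continuous f} -> L2 a b f.
Proof.
move=> cf; split; first by apply: L1_measurable; exact: continuous_L1.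
by apply: continuous_L1; exact: (within_continuousM cf cf).
Qed.

Lemma continuous_horner (p : {poly R}) (A : set R) :
  {within A, continuous (horner p)}.
Proof.
apply: continuous_subspaceT => x.
apply/differentiable_continuous/derivable1_diffP; exact: derivable_horner.
Qed.

Lemma L2_horner a b (p : {poly R}) : L2 a b (horner p).
Proof. exact/continuous_L2/continuous_horner. Qed.

Lemma L2_sub a b a' b' f : a <= a' -> b' <= b -> L2 a b f -> L2 a' b' f.
Proof.
move=> aa bb [mf lf]; split; last exact: L1_sub lf.
by apply: measurable_funS mf; [exact: measurable_Icc|exact: sub_Icc].
Qed.

Lemma L2M a b f g : L2 a b f -> L2 a b g -> L1 a b (fun x => f x * g x).
Proof.
move=> [mf lf] [mg lg]; apply: (L1_le _ (L1D lf lg)).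
  exact: measurable_funM.
move=> x _; rewrite normrM -(real_normK (num_real (f x))).
rewrite -(real_normK (num_real (g x))).
have := sqr_ge0 (`|f x| - `|g x|); have := normr_ge0 (f x).
have := normr_ge0 (g x); nra.
Qed.

Lemma L2_L1 a b f : L2 a b f -> L1 a b f.
Proof.
move=> lf; have l1 : L2 a b (fun=> 1 : R).
  by split => //; under eq_fun do rewrite expr1n; exact: L1_cst.
by apply: L1_eq (L2M lf l1) => x _; rewrite mulr1.
Qed.

Lemma L2Z a b k f : L2 a b f -> L2 a b (fun x => k * f x).
Proof.
move=> [mf lf]; split; first exact: measurable_funM.
by apply: L1_eq (L1Z (k ^+ 2) lf) => x _; rewrite exprMn.
Qed.

Lemma L2D a b f g : L2 a b f -> L2 a b g -> L2 a b (fun x => f x + g x).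
Proof.
move=> lf lg; split; first by apply: measurable_funD; [case: lf|case: lg].
have := L1D (L1D lf.2 lg.2) (L1Z 2 (L2M lf lg)).
by apply: L1_eq => x _ /=; ring.
Qed.

Lemma L2N a b f : L2 a b f -> L2 a b (fun x => - f x).
Proof.
move=> /(L2Z (-1)); congr (L2 _ _ _).
by apply/funext => x; rewrite mulN1r.
Qed.

Lemma L2B a b f g : L2 a b f -> L2 a b g -> L2 a b (fun x => f x - g x).
Proof. by move=> lf /L2N; exact: L2D. Qed.

Lemma L2_eq a b f g : (forall x, a <= x <= b -> f x = g x) ->
  L2 a b f -> L2 a b g.
Proof.
move=> fg [mf lf]; split; last by apply: L1_eq lf => x abx; rewrite fg.
apply: eq_measurable_fun mf => x; rewrite inE => /mem_Icc; exact: fg.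
Qed.

Lemma integ_eq a b f g : (forall x, a <= x <= b -> f x = g x) ->
  integ a b f = integ a b g.
Proof. by move=> fg; apply: eq_Rintegral => x; rewrite inE => /mem_Icc/fg. Qed.

Lemma integD a b f g : L1 a b f -> L1 a b g ->
  integ a b (fun x => f x + g x) = integ a b f + integ a b g.
Proof. exact: RintegralD. Qed.

Lemma integB a b f g : L1 a b f -> L1 a b g ->
  integ a b (fun x => f x - g x) = integ a b f - integ a b g.
Proof. exact: RintegralB. Qed.

Lemma integZ a b k f : L1 a b f ->
  integ a b (fun x => k * f x) = k * integ a b f.
Proof. exact: RintegralZl. Qed.

Lemma integ_sum a b (I : Type) (s : seq I) (F : I -> R -> R) :
  (forall i, L1 a b (F i)) ->
  integ a b (fun x => \sum_(i <- s) F i x) = \sum_(i <- s) integ a b (F i).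
Proof.
move=> lF; elim: s => [|i s IH].
  rewrite big_nil (@integ_eq _ _ _ (fun=> 0 * 0)) => [|x _].
    by rewrite integZ ?mul0r//; exact: L1_cst.
  by rewrite big_nil mul0r.
rewrite big_cons -IH -integD//; last exact: L1_sum.
by apply: integ_eq => x _; rewrite big_cons.
Qed.

Lemma integ_cst a b k : a <= b -> integ a b (fun=> k) = k * (b - a).
Proof.
move=> ab; rewrite /integ Rintegral_cst//= lebesgue_measure_itv/= lte_fin.
by move: ab; rewrite le_eqVlt => /orP[/eqP->|->//]; rewrite ltxx subrr.
Qed.

Lemma integ_ge0 a b f : (forall x, a <= x <= b -> 0 <= f x) ->
  0 <= integ a b f.
Proof. by move=> f0; apply: Rintegral_ge0 => x /mem_Icc; exact: f0. Qed.

Lemma integ_le a b f g : L1 a b f -> L1 a b g ->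
  (forall x, a <= x <= b -> f x <= g x) -> integ a b f <= integ a b g.
Proof. by move=> lf lg fg; apply: le_Rintegral => // x /mem_Icc; exact: fg. Qed.

Lemma integ_norm a b f : L1 a b f ->
  `|integ a b f| <= integ a b (fun x => `|f x|).
Proof. exact: le_normr_Rintegral. Qed.

Lemma integ_id a f : integ a a f = 0.
Proof. by rewrite /integ /Icc set_itv1 Rintegral_set1. Qed.

Lemma integ_cat a b c f : a <= b -> b <= c -> L1 a c f ->
  integ a c f = integ a b f + integ b c f.
Proof.
move=> ab bc lf; apply/eqP; rewrite addrC -subr_eq; apply/eqP.
rewrite /integ /Icc Rintegral_itvB//; [|by rewrite bnd_simp..].
by rewrite Rintegral_itv_obnd_cbnd//; apply: integrableS lf => //;
  apply: subset_itv; rewrite bnd_simp.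
Qed.

Lemma integ_CS a b f g : L2 a b f -> L2 a b g ->
  integ a b (fun x => f x * g x) ^+ 2 <=
  integ a b (fun x => f x ^+ 2) * integ a b (fun x => g x ^+ 2).
Proof.
move=> lf lg.
set X := integ _ _ (fun x => f x * g x).
set F := integ _ _ (fun x => f x ^+ 2); set G := integ _ _ (fun x => g x ^+ 2).
have F0 : 0 <= F by apply: integ_ge0 => x _; exact: sqr_ge0.
have G0 : 0 <= G by apply: integ_ge0 => x _; exact: sqr_ge0.
have H s t : 0 <= s ^+ 2 * F + (t ^+ 2 * G + 2 * s * t * X).
  rewrite /F /G /X -!integZ; [|exact: L2M|exact: lg.2|exact: lf.2].
  rewrite -integD; [|exact/L1Z/lg.2|exact/L1Z/L2M].
  rewrite -integD; [|exact/L1Z/lf.2|by apply: L1D; [exact/L1Z/lg.2|exact/L1Z/L2M]].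
  apply: integ_ge0 => x _; rewrite (_ : _ + _ = (s * f x + t * g x) ^+ 2).
    exact: sqr_ge0.
  by ring.
have [G00|G0'] := eqVneq G 0.
  suff -> : X = 0 by rewrite expr0n/= mulr_ge0.
  apply/eqP; apply: contraT => X0.
  (* With [G = 0] and [X] nonzero, this [t] would give the quadratic form the value [-1]. *)
  have := H 1 (- (F + 1) / (2 * X)); rewrite G00.
  rewrite mulr0 add0r expr1n !mul1r mulr1.
  have -> : 2 * (- (F + 1) / (2 * X)) * X = - (F + 1) by field.
  lra.
(* For [s = G] this [t] minimises the form; its value there is [G (F G - X^2)]. *)
have := H G (- X).
rewrite (_ : _ + _ = G * (F * G - X ^+ 2)); last by ring.
by rewrite pmulr_rge0 ?lt_neqAle ?G0 1?eq_sym ?G0'// subr_ge0.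
Qed.

Lemma integ_sq a b f : a <= b -> L2 a b f ->
  integ a b f ^+ 2 <= (b - a) * integ a b (fun x => f x ^+ 2).
Proof.
move=> ab lf; have l1 : L2 a b (fun=> 1 : R).
  by split => //; under eq_fun do rewrite expr1n; exact: L1_cst.
have := integ_CS l1 lf.
rewrite (_ : integ a b (fun=> 1 ^+ 2) = b - a) => [|]; last first.
  by under [X in integ _ _ X]eq_fun do rewrite expr1n; rewrite integ_cst ?mul1r.
by congr (_ ^+ 2 <= _); apply: integ_eq => x _; rewrite mul1r.
Qed.

End SquareIntegrable.

(** * Primitives of square-integrable functions and integration by parts *)

Section AbsolutelyContinuous.
Context {R : realType}.
Notation mu := (@lebesgue_measure R).
Implicit Types (a b c : R) (f g : R -> R).

(** [f] is an [H^1] function and [g] a chosen version of its weak derivative. Keeping [g] as data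
    avoids differentiation almost everywhere. *)
Definition AC a b f g : Prop :=
  L2 a b g /\ forall t, a <= t <= b -> f t = f a + integ a t g.

Lemma AC_diff a b f g s t : AC a b f g -> a <= s -> s <= t -> t <= b ->
  f t - f s = integ s t g.
Proof.
move=> [lg fE] as_ st tb.
rewrite (fE t) ?(le_trans as_ st)// (fE s) ?as_ ?(le_trans st tb)//.
rewrite (integ_cat as_ st); last exact: L1_sub (L2_L1 lg).
ring.
Qed.

Lemma AC_sub a b a' b' f g : a <= a' -> a' <= b' -> b' <= b ->
  AC a b f g -> AC a' b' f g.
Proof.
move=> aa ab bb H; split; first exact: L2_sub H.1.
move=> t /andP[a't tb']; rewrite -(AC_diff H aa a't (le_trans tb' bb)); ring.
Qed.

Lemma AC_sq a b f g s t : AC a b f g -> a <= s -> s <= t -> t <= b ->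
  (f t - f s) ^+ 2 <= (t - s) * integ s t (fun x => g x ^+ 2).
Proof.
move=> H as_ st tb; rewrite (AC_diff H as_ st tb).
by apply: integ_sq => //; exact: L2_sub H.1.
Qed.

Lemma integ_sub_le a b s t g : a <= s -> s <= t -> t <= b -> L1 a b g ->
  (forall x, a <= x <= b -> 0 <= g x) -> integ s t g <= integ a b g.
Proof.
move=> as_ st tb lg g0.
rewrite (integ_cat (le_trans as_ st) tb lg).
rewrite (integ_cat as_ st); last exact: L1_sub lg.
have h1 : 0 <= integ a s g.
  apply: integ_ge0 => x /andP[ax xs]; apply: g0.
  by rewrite ax (le_trans xs)// (le_trans st).
have h2 : 0 <= integ t b g.
  apply: integ_ge0 => x /andP[tx xb]; apply: g0.
  by rewrite xb (le_trans as_)// (le_trans st).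
by rewrite -addrA addrCA lerDl addr_ge0.
Qed.

Lemma AC_sq_le a b f g s t : AC a b f g -> a <= s -> s <= t -> t <= b ->
  (f t - f s) ^+ 2 <= (t - s) * integ a b (fun x => g x ^+ 2).
Proof.
move=> H as_ st tb; rewrite (le_trans (AC_sq H as_ st tb))//.
rewrite ler_wpM2l ?subr_ge0// integ_sub_le//; first exact: H.1.2.
by move=> x _; exact: sqr_ge0.
Qed.

Lemma AC_continuous a b f g : a <= b -> AC a b f g ->
  {within Icc a b, continuous f}.
Proof.
move=> ab [lg fE].
have /(_ _ _ _ ab (L2_L1 lg)) := @parameterized_integral_continuous R.
move=> cI.
have : {within Icc a b, continuous (fun x => f a + integ a x g)}.
  by move=> x; apply: cvgD; [exact: cvg_cst|exact: cI].
apply: subspace_eq_continuous => x /set_mem/mem_Icc abx.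
exact: (esym (fE x abx)).
Qed.

Lemma AC_L2 a b f g : a <= b -> AC a b f g -> L2 a b f.
Proof. by move=> ab H; apply: continuous_L2; exact: AC_continuous H. Qed.

Lemma AC_horner a b (p : {poly R}) : AC a b (horner p) (horner p^`()).
Proof.
split; first exact: L2_horner.
move=> t /andP[]; rewrite le_eqVlt => /orP[/eqP<- _|at_ tb].
  by rewrite integ_id addr0.
have cp (q : {poly R}) : continuous (horner q).
  move=> x; apply/differentiable_continuous/derivable1_diffP.
  exact: derivable_horner.
rewrite /integ /Rintegral (@continuous_FTC2 _ _ (horner p))//=; first by ring.
- exact: continuous_horner.
- split.
  + by move=> x _; exact: derivable_horner.
  + by apply: cvg_at_right_filter; exact: cp.
  + by apply: cvg_at_left_filter; exact: cp.
- by move=> x _; rewrite derivE.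
Qed.

Lemma ACB a b f f' g g' : AC a b f g -> AC a b f' g' ->
  AC a b (fun x => f x - f' x) (fun x => g x - g' x).
Proof.
move=> [lg fE] [lg' fE']; split; first exact: L2B.
move=> t abt; rewrite integB.
- by rewrite (fE _ abt) (fE' _ abt); ring.
- by apply: L1_sub (L2_L1 lg) => //; case/andP: abt.
- by apply: L1_sub (L2_L1 lg') => //; case/andP: abt.
Qed.

Lemma horner_bounded a b (p : {poly R}) :
  exists2 K, 0 <= K & forall x, a <= x <= b -> `|p.[x]| <= K.
Proof.
elim/poly_ind: p => [|p c [K K0 pK]].
  by exists 0 => // x _; rewrite horner0 normr0.
exists (K * (`|a| + `|b|) + `|c|).
  by rewrite addr_ge0// mulr_ge0// addr_ge0.
move=> x abx; rewrite hornerD hornerC hornerMX (le_trans (ler_normD _ _))//.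
rewrite lerD2r normrM ler_pM//; first exact: pK.
have := ler_norm b; have := ler_norm (- a); rewrite normrN.
have := normr_ge0 a; have := normr_ge0 b; case/andP: abx => ax xb.
by rewrite ler_norml; move=> *; apply/andP; split; lra.
Qed.

(* Halving the interval gains a factor 2 since [2 * 2 * (1/2)^3 = 1/2]. *)
Lemma eq_of_cubic_increments a b f C : a <= b -> 0 <= C ->
  (forall s t, a <= s -> s <= t -> t <= b ->
     (f t - f s) ^+ 2 <= C * (t - s) ^+ 3) -> f a = f b.
Proof.
move=> ab C0 fC.
have H n : forall s t, a <= s -> s <= t -> t <= b ->
    2 ^+ n * (f t - f s) ^+ 2 <= C * (t - s) ^+ 3.
  elim: n => [|n IH] s t as_ st tb; first by rewrite mul1r fC.
  have h1 := IH s ((s + t) / 2) as_ ltac:(lra) ltac:(lra).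
  have h2 := IH ((s + t) / 2) t ltac:(lra) ltac:(lra) tb.
  set m := (s + t) / 2 in h1 h2 *.
  have -> : f t - f s = (f m - f s) + (f t - f m) by ring.
  set x := f m - f s in h1 *; set y := f t - f m in h2 *.
  have n0 : 0 <= (2 : R) ^+ n by exact: exprn_ge0.
  have xy : 2 ^+ n * (x + y) ^+ 2 <= 2 * (2 ^+ n * x ^+ 2) + 2 * (2 ^+ n * y ^+ 2).
    rewrite -subr_ge0 (_ : _ - _ = 2 ^+ n * (x - y) ^+ 2); last by ring.
    by rewrite mulr_ge0// sqr_ge0.
  rewrite exprS -mulrA.
  have ms : m - s = (t - s) / 2 by rewrite /m; field.
  have tm : t - m = (t - s) / 2 by rewrite /m; field.
  rewrite ms in h1; rewrite tm in h2.
  have e : (C * ((t - s) / 2) ^+ 3) = C * (t - s) ^+ 3 / 8 by field.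
  rewrite e in h1 h2; lra.
apply/eqP; rewrite eq_sym -subr_eq0 -sqrf_eq0; apply/negPn/negP => d_neq0.
have d0 : 0 < (f b - f a) ^+ 2 by rewrite lt_neqAle eq_sym d_neq0 sqr_ge0.
set c := C * (b - a) ^+ 3.
have c0 : 0 <= c by rewrite mulr_ge0// exprn_ge0// subr_ge0.
have /archi_boundP := divr_ge0 c0 (ltW d0); set n := Num.bound _.
rewrite ltNge => /negP; apply.
rewrite ler_pdivlMr// (le_trans _ (H n a b _ ab _))// ler_wpM2r ?sqr_ge0//.
by rewrite -natrX ler_nat ltnW// ltn_expl.
Qed.

(** Replaces the product rule, for want of a pointwise derivative of [f]. The defect [F] has squared
    increments at most [4 G K^2 (t - s)^3], where [K] bounds the derivative of [Q], so it is
    constant. *)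
Lemma integ_by_parts a b f g (Q : {poly R}) : a <= b -> AC a b f g ->
  Q.[a] = 0 -> Q.[b] = 0 ->
  integ a b (fun x => f x * Q^`().[x]) = - integ a b (fun x => g x * Q.[x]).
Proof.
move=> ab H Qa Qb.
have [lg fE] := H; have lf := AC_L2 ab H.
have lQ := L2_horner a b Q; have lQ' := L2_horner a b Q^`().
have [K K0 QK] := horner_bounded a b Q^`().
pose G := integ a b (fun x => g x ^+ 2).
have G0 : 0 <= G by apply: integ_ge0 => x _; exact: sqr_ge0.
pose F t := integ a t (fun x => g x * Q.[x]) +
  integ a t (fun x => f x * Q^`().[x]) - f t * Q.[t].
suff : F a = F b by rewrite /F !integ_id Qa Qb; lra.
apply: (@eq_of_cubic_increments _ _ _ (4 * G * K ^+ 2)) => //.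
  by rewrite !mulr_ge0// sqr_ge0.
move=> s t as_ st tb.
have at_ := le_trans as_ st; have sb := le_trans st tb.
have sub h : L2 a b h -> L2 s t h by exact: L2_sub.
have lc k : L2 s t (fun=> k : R).
  by apply: L2_eq (L2_horner s t k%:P) => x _; rewrite hornerC.
(* Subtracting the constants [Q(t)] and [f(s)] leaves in each integral a derivative times an
   increment; Cauchy-Schwarz bounds the square of either one by [G K^2 (t - s)^3]. *)
have FE : F t - F s = integ s t (fun x => g x * (Q.[x] - Q.[t])) +
                      integ s t (fun x => (f x - f s) * Q^`().[x]).
  rewrite /F (integ_cat as_ st); last first.
    by apply: L1_sub (L2M lg lQ).
  rewrite (integ_cat as_ st); last by apply: L1_sub (L2M lf lQ').
  have -> : integ s t (fun x => g x * (Q.[x] - Q.[t])) =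
      integ s t (fun x => g x * Q.[x]) - (f t - f s) * Q.[t].
    rewrite (AC_diff H as_ st tb) mulrC -integZ; last exact/L2_L1/sub.
    rewrite -integB; [|exact: L2M (sub _ lg) (sub _ lQ)|exact/L1Z/L2_L1/sub].
    by apply: integ_eq => x _; ring.
  have -> : integ s t (fun x => (f x - f s) * Q^`().[x]) =
      integ s t (fun x => f x * Q^`().[x]) - f s * (Q.[t] - Q.[s]).
    rewrite (AC_diff (AC_horner a b Q) as_ st tb) -integZ; last exact/L2_L1/sub.
    rewrite -integB; [|exact: L2M (sub _ lf) (sub _ lQ')|exact/L1Z/L2_L1/sub].
    by apply: integ_eq => x _; ring.
  ring.
have sq2 (x y : R) : (x + y) ^+ 2 <= 2 * x ^+ 2 + 2 * y ^+ 2.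
  by have := sqr_ge0 (x - y); nra.
have ts0 : 0 <= t - s by rewrite subr_ge0.
have Gst : integ s t (fun x => g x ^+ 2) <= G.
  by apply: integ_sub_le => //; [exact: lg.2|move=> x _; exact: sqr_ge0].
have Q'st s' t' : a <= s' -> s' <= t' -> t' <= b ->
    integ s' t' (fun x => Q^`().[x] ^+ 2) <= K ^+ 2 * (t' - s').
  move=> as' st' tb'; rewrite -integ_cst//; apply: integ_le => //.
  - exact: (L2_horner _ _ _).2.
  - exact: L1_cst.
  - move=> x /andP[sx xt]; rewrite -real_normK ?num_real// lerXn2r ?nnegrE//.
    by apply: QK; rewrite (le_trans as')// (le_trans xt).
rewrite FE (le_trans (sq2 _ _))//.
have -> : 4 * G * K ^+ 2 * (t - s) ^+ 3 =
   2 * (G * (K ^+ 2 * (t - s) ^+ 2 * (t - s))) +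
   2 * ((t - s) * G * (t - s) * (K ^+ 2 * (t - s))) by ring.
apply: lerD; rewrite ler_pM2l//.
- apply: (le_trans (integ_CS (sub _ lg) (L2B (sub _ lQ) (lc Q.[t])))).
  rewrite ler_pM//.
  + by apply: integ_ge0 => x _; exact: sqr_ge0.
  + by apply: integ_ge0 => x _; exact: sqr_ge0.
  rewrite -integ_cst//; apply: integ_le => //.
  + exact: (L2B (sub _ lQ) (lc Q.[t])).2.
  + exact: L1_cst.
  + move=> x /andP[sx xt]; rewrite -sqrrN opprB.
    have ax := le_trans as_ sx.
    apply: (le_trans (AC_sq (AC_horner a b Q) ax xt tb)).
    have xt0 : 0 <= t - x by rewrite subr_ge0.
    apply: (le_trans (ler_wpM2l xt0 (Q'st _ _ ax xt tb))).
    rewrite mulrCA -expr2 ler_wpM2l ?sqr_ge0//.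
    by rewrite lerXn2r ?nnegrE// lerD2l lerN2.
- apply: (le_trans (integ_CS (L2B (sub _ lf) (lc (f s))) (sub _ lQ'))).
  rewrite ler_pM//.
  + by apply: integ_ge0 => x _; exact: sqr_ge0.
  + by apply: integ_ge0 => x _; exact: sqr_ge0.
  + rewrite -integ_cst//; apply: integ_le => //.
    * exact: (L2B (sub _ lf) (lc (f s))).2.
    * exact: L1_cst.
    * move=> x /andP[sx xt].
      apply: (le_trans (AC_sq_le H as_ sx (le_trans xt tb))).
      by rewrite ler_wpM2r// lerD2r.
  + exact: Q'st.
Qed.

End AbsolutelyContinuous.

(** * Weierstrass approximation by Bernstein polynomials *)

Section Bernstein.
Context {R : realType}.
Implicit Types (x c d : R) (F : nat -> R).

(* Bernstein polynomial in de Casteljau form: [bernstein n F k] interpolates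
   the window [F k, .., F (k + n)]; its moments follow by induction on [n]. *)
Fixpoint bernstein (n : nat) F (k : nat) : {poly R} :=
  if n is n'.+1 then 'X * bernstein n' F k.+1 + (1 - 'X) * bernstein n' F k
  else (F k)%:P.

(** Averaging over [j = k + B], with [B] binomial of parameters [n] and [x]: the bracket is the
    squared bias plus the variance [n x (1 - x)]. A quadratic bound is reproduced exactly by one de
    Casteljau step, hence the form of the hypothesis. *)
Lemma bernstein_near n F k x c d al be : 0 <= x <= 1 ->
  (forall j, (k <= j <= k + n)%N ->
     `|F j - c| <= al + be * (j%:R - d) ^+ 2) ->
  `|(bernstein n F k).[x] - c| <=
    al + be * ((k%:R + n%:R * x - d) ^+ 2 + n%:R * x * (1 - x)).
Proof.
move=> x01; elim: n k => [|n IH] k HF.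
  rewrite /= hornerC !mul0r !addr0; apply: HF.
  by rewrite addn0 leqnn.
have h1 := IH k.+1; have h2 := IH k.
have {}h1 : `|(bernstein n F k.+1).[x] - c| <=
   al + be * ((k.+1%:R + n%:R * x - d) ^+ 2 + n%:R * x * (1 - x)).
  by apply: h1 => j /andP[kj jn]; apply: HF; rewrite (ltnW kj) addnS -addSn.
have {}h2 : `|(bernstein n F k).[x] - c| <=
   al + be * ((k%:R + n%:R * x - d) ^+ 2 + n%:R * x * (1 - x)).
  apply: h2 => j /andP[kj jn]; apply: HF.
  by rewrite kj (leq_trans jn)// leq_add2l.
rewrite /= !hornerE.
set A := (bernstein n F k.+1).[x] in h1 *.
set B := (bernstein n F k).[x] in h2 *.
have -> : x * A + (1 - x) * B - c = x * (A - c) + (1 - x) * (B - c) by ring.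
case/andP: x01 => x0 x1; have x1' : 0 <= 1 - x by rewrite subr_ge0.
apply: (le_trans (ler_normD _ _)); rewrite !normrM (ger0_norm x0) (ger0_norm x1').
apply: (le_trans (lerD (ler_wpM2l x0 h1) (ler_wpM2l x1' h2))).
rewrite -!natr1; rewrite le_eqVlt; apply/orP; left; apply/eqP; ring.
Qed.

End Bernstein.

Section Weierstrass.
Context {R : realType}.
Notation mu := (@lebesgue_measure R).
Implicit Types (a b : R) (f g : R -> R).

(** The Hölder bound of exponent [1/2] given by Cauchy-Schwarz is weakened, by Young's inequality
    used twice, to the quadratic form that [bernstein_near] averages. *)
Lemma AC_modulus a b f g e : a < b -> AC a b f g -> 0 < e ->
  exists2 be, 0 <= be & forall s t, a <= s <= b -> a <= t <= b ->
    `|f s - f t| <= e + be * (s - t) ^+ 2.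
Proof.
move=> ab H e0; set G := integ a b (fun x => g x ^+ 2).
have G0 : 0 <= G by apply: integ_ge0 => x _; exact: sqr_ge0.
have e4 : 0 < 4 * e by lra.
(* Chosen so that [z G <= e^2]; the [+ 1] covers [G = 0]. *)
pose z := e * e / (G + 1).
have z0 : 0 < z by rewrite divr_gt0 ?mulr_gt0// ltr_wpDl.
have zG : z * G <= e * e.
  by rewrite /z mulrAC ler_pdivrMr ?ltr_wpDl// ler_wpM2l ?lerDl// ltW// !mulr_gt0.
pose be := G / (4 * z) / (2 * e).
have be0 : 0 <= be.
  by apply: divr_ge0; [apply: divr_ge0 => //|]; apply: mulr_ge0 => //; exact: ltW.
exists be => // s t.
wlog st : s t / t <= s => [W|].
  case: (leP t s) => [ts|/ltW st] sab tab; first exact: W.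
  by rewrite distrC -sqrrN opprB W.
move=> /andP[as_ sb] /andP[at_ tb].
have := AC_sq_le H at_ st sb; rewrite -/G => fst.
set u := `|f s - f t|; set v := s - t in fst *.
have v0 : 0 <= v by rewrite subr_ge0.
have u2 : u ^+ 2 <= v * G by rewrite /u real_normK ?num_real.
have hv : v <= z + v ^+ 2 / (4 * z).
  rewrite -subr_ge0 (_ : _ - _ = (v - 2 * z) ^+ 2 / (4 * z)).
    by rewrite divr_ge0 ?sqr_ge0// mulr_ge0// ltW.
  by field; rewrite gt_eqF.
have hu : u <= e / 2 + u ^+ 2 / (2 * e).
  rewrite -subr_ge0 (_ : _ - _ = (u - e) ^+ 2 / (2 * e)).
    by rewrite divr_ge0 ?sqr_ge0// mulr_ge0// ltW.
  by field; rewrite gt_eqF.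
have hG : u ^+ 2 / (2 * e) <= e / 2 + be * v ^+ 2.
  rewrite ler_pdivrMr ?mulr_gt0//.
  have -> : (e / 2 + be * v ^+ 2) * (2 * e) = e * e + v ^+ 2 / (4 * z) * G.
    by rewrite /be; field; rewrite !gt_eqF.
  rewrite (le_trans u2)// (le_trans (ler_wpM2r G0 hv))// mulrDl.
  by rewrite lerD2r.
lra.
Qed.

Lemma weierstrass_AC a b f g e : a < b -> AC a b f g -> 0 < e ->
  exists q : {poly R}, forall t, a <= t <= b -> `|f t - q.[t]| <= e.
Proof.
move=> ab H e0.
have ba0 : 0 < b - a by rewrite subr_gt0.
have [|be be0 fbe] := AC_modulus ab H (_ : 0 < e / 2); first by rewrite divr_gt0.
(* Makes the variance term at most [e x (1 - x) <= e / 4]. *)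
pose n := (Num.bound (be * (b - a) ^+ 2 / e)).+1.
have n0 : 0 < n%:R :> R by rewrite ltr0n.
have nb : be * (b - a) ^+ 2 / e <= n%:R.
  rewrite ltW// (lt_le_trans (archi_boundP _))//.
    by rewrite divr_ge0 ?(ltW e0)// mulr_ge0// sqr_ge0.
  by rewrite ler_nat /n.
pose F k := f (a + (b - a) * (k%:R / n%:R)).
exists (bernstein n F 0 \Po ((b - a)^-1 *: ('X - a%:P))) => t tab.
rewrite horner_comp hornerZ hornerXsubC distrC.
set x := (b - a)^-1 * (t - a).
have tE : t = a + (b - a) * x.
  by rewrite /x mulrA mulfV ?gt_eqF// mul1r addrC subrK.
have x01 : 0 <= x <= 1.
  case/andP: tab => at_ tb; rewrite /x mulr_ge0 ?invr_ge0 ?(ltW ba0) ?subr_ge0//=.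
  by rewrite mulrC ler_pdivrMr// mul1r lerD2r.
have HF j : (0 <= j <= 0 + n)%N -> `|F j - f t| <=
    e / 2 + be * (b - a) ^+ 2 / n%:R ^+ 2 * (j%:R - n%:R * x) ^+ 2.
  move=> /andP[_ jn].
  have jn1 : 0 <= (j%:R / n%:R : R) <= 1.
    rewrite divr_ge0//= ler_pdivrMr// mul1r ler_nat; exact: jn.
  have -> : e / 2 + be * (b - a) ^+ 2 / n%:R ^+ 2 * (j%:R - n%:R * x) ^+ 2 =
     e / 2 + be * (a + (b - a) * (j%:R / n%:R) - t) ^+ 2.
    by rewrite tE; field; rewrite gt_eqF.
  apply: fbe => //; case/andP: jn1 => j0 j1.
  rewrite lerDl mulr_ge0 ?(ltW ba0)//=.
  by rewrite -lerBrDl ger_pMr.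
apply: (le_trans (bernstein_near x01 HF)).
rewrite add0r subrr expr0n/= add0r.
have -> : be * (b - a) ^+ 2 / n%:R ^+ 2 * (n%:R * x * (1 - x)) =
   be * (b - a) ^+ 2 / n%:R * (x * (1 - x)) by field; rewrite gt_eqF.
have hn : be * (b - a) ^+ 2 / n%:R <= e.
  by rewrite ler_pdivrMr// [leRHS]mulrC -ler_pdivrMr.
have hx : x * (1 - x) <= 1 / 4.
  have := sqr_ge0 (x - 1 / 2); nra.
have x0 : 0 <= x * (1 - x) by case/andP: x01 => *; rewrite mulr_ge0// subr_ge0.
have c0 : 0 <= be * (b - a) ^+ 2 / n%:R.
  by apply: divr_ge0 => //; rewrite mulr_ge0// sqr_ge0.
have := ler_pM c0 x0 hn hx; lra.
Qed.

End Weierstrass.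

(** * Shifted Legendre polynomials and their Sturm-Liouville operator *)

Section Legendre.
Context {R : realType}.
Implicit Types (f g : R -> R) (p q : {poly R}).

Section Polynomials.
Variables (a b : R).

Definition legendre_weight : {poly R} := ('X - a%:P) * (b%:P - 'X).

(** The Sturm-Liouville operator of the Legendre equation on [[a, b]], with eigenvalues
    [k (k + 1)]. *)
Definition legendre_op p : {poly R} := - (legendre_weight * p^`())^`().

(** The recurrence obtained by matching the coefficients of [(x - a)^j] in the eigenvalue equation.
    Its factor first vanishes when [j'] reaches [k], so the series stops at degree exactly [k]. *)
Fixpoint legendre_coef (k j : nat) : R :=
  if j is j'.+1 then
    legendre_coef k j' * ((j' * j'.+1)%:R - (k * k.+1)%:R) /
      ((b - a) * j'.+1%:R ^+ 2)
  else 1.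

(* Unnormalised shifted Legendre polynomial, as the solution of
   [legendre_op p = k (k + 1) p] given by its power series at [a]. *)
Definition legendre (k : nat) : {poly R} :=
  (\poly_(j < k.+1) legendre_coef k j) \Po ('X - a%:P).

Lemma legendre_coef_neq0 k j : a < b -> (j <= k)%N -> legendre_coef k j != 0.
Proof.
move=> ab; elim: j => [|j IH] jk /=; first exact: oner_neq0.
have ba : b - a != 0 by rewrite subr_eq0 gt_eqF.
rewrite mulf_neq0 ?invr_neq0 ?mulf_neq0 ?expf_neq0 ?pnatr_eq0 ?IH ?(ltnW jk)//.
rewrite subr_eq0 eqr_nat; apply/negP => /eqP; nia.
Qed.

Lemma size_legendre k : a < b -> size (legendre k) = k.+1.
Proof.
move=> ab; rewrite /legendre size_comp_poly2 ?size_XsubC//.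
by rewrite size_poly_eq// legendre_coef_neq0.
Qed.

Lemma legendre_opE k : a < b ->
  legendre_op (legendre k) = (k * k.+1)%:R *: legendre k.
Proof.
move=> ab; rewrite /legendre_op /legendre.
set p := \poly_(j < k.+1) _; set s := 'X - a%:P.
have sE : legendre_weight = ('X * ((b - a)%:P - 'X)) \Po s.
  rewrite /legendre_weight comp_polyM comp_polyB comp_polyX comp_polyC.
  by rewrite /s polyCB; ring.
have ds : s^`() = 1 by rewrite derivB derivX derivC subr0.
rewrite deriv_comp ds mulr1 sE -comp_polyM deriv_comp ds mulr1.
rewrite -raddfN/= -comp_polyZ; congr (_ \Po _).
have ba : b - a != 0 by rewrite subr_eq0 gt_eqF.
apply/polyP => j; rewrite coefN coef_deriv coefZ mulrBr mulrBl.
have -> : 'X * (b - a)%:P * p^`() = (b - a) *: ('X * p^`()).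
  by rewrite -mul_polyC; ring.
have -> : 'X * 'X * p^`() = 'X * ('X * p^`()) by rewrite mulrA.
rewrite coefB coefZ !coefXM /= !coef_deriv.
have -> : (if j == 0%N then 0 else p`_j.-1.+1 *+ j.-1.+1) = p`_j *+ j.
  by case: j.
rewrite /p !coef_poly !ltnS.
have [jk|jk] := leqP j k; last first.
  by rewrite (ltn_geF (leqW jk)) !mul0rn mulr0 subrr mul0rn oppr0 mulr0.
have [jk'|kj] := ltnP j k; last first.
  have -> : j = k by apply/eqP; rewrite eqn_leq jk kj.
  set c := legendre_coef k k.
  rewrite mul0rn mulr0 sub0r -[_ *+ k.+1]mulr_natr -[c *+ k]mulr_natr natrM.
  by ring.
rewrite /=; set c := legendre_coef k j; set d := _ / _.
rewrite -[_ *+ j.+1]mulr_natr -[d *+ j.+1]mulr_natr -[c *+ j]mulr_natr.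
have j0 : j.+1%:R != 0 :> R by rewrite pnatr_eq0.
rewrite {}/d !natrM; move: j0; rewrite -(natr1 j) => j0; field.
by rewrite ba j0.
Qed.

(** The [k]-th Legendre polynomial has exact degree [k], so leading coefficients can be removed one
    at a time. This serves as the statement that the first [n] of them span. *)
Lemma legendre_ind (P : {poly R} -> Prop) n : a < b ->
  P 0 -> (forall k c q, (k < n)%N -> P q -> P (c *: legendre k + q)) ->
  forall q, (size q <= n)%N -> P q.
Proof.
move=> ab P0 PS; elim: n PS => [|n IH] PS q qn.
  by move: qn; rewrite leqn0 size_poly_eq0 => /eqP->.
have szL := size_legendre n ab.
have lc : lead_coef (legendre n) != 0.
  by rewrite lead_coef_eq0 -size_poly_eq0 szL.
pose c := q`_n / lead_coef (legendre n).
have -> : q = c *: legendre n + (q - c *: legendre n) by rewrite addrC subrK.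
apply: (PS n c _ (ltnSn n)); apply: IH => [k d q' kn|].
  by apply: (PS); exact: leqW.
apply/leq_sizeP => j; rewrite leq_eqVlt => /orP[/eqP<-|nj].
  rewrite coefB coefZ /c; move: lc; rewrite lead_coefE szL /= => lc.
  by rewrite divfK// subrr.
rewrite coefB coefZ !nth_default ?mulr0 ?subrr ?szL//.
exact: leq_trans nj.
Qed.

End Polynomials.

(** The weight vanishes at both ends, so integration by parts leaves no boundary term. *)
Lemma integ_legendre_op a b f g p : a <= b -> AC a b f g ->
  integ a b (fun x => f x * (legendre_op a b p).[x]) =
  integ a b (fun x => g x * ((legendre_weight a b).[x] * p^`().[x])).
Proof.
move=> ab H; have := integ_by_parts (Q := legendre_weight a b * p^`()) ab H.
rewrite !hornerE !subrr !(mul0r, mulr0) => /(_ erefl erefl) E.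
transitivity (- integ a b
  (fun x => f x * ((legendre_weight a b * p^`())^`()).[x])).
  rewrite -mulN1r -integZ; last exact: L2M (AC_L2 ab H) (L2_horner _ _ _).
  by apply: integ_eq => x _; rewrite hornerN; ring.
by rewrite E opprK; apply: integ_eq => x _; rewrite hornerM.
Qed.

(** * Legendre expansions and the projection error *)

Section Projection.
Variables (a b : R).
Hypothesis ab : a < b.

Let ip f g := integ a b (fun x => f x * g x).
Let L k := horner (legendre a b k).

Local Lemma ipC f g : ip f g = ip g f.
Proof. by apply: integ_eq => x _; rewrite mulrC. Qed.

Local Lemma LL2 k : L2 a b (L k). Proof. exact: L2_horner. Qed.

(** The operator is symmetric by [integ_legendre_op], and the eigenvalues [k (k + 1)] are
    distinct. *)
Local Lemma ip_legendre i j : i != j -> ip (L i) (L j) = 0.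
Proof.
move=> ij.
have E k l : (l * l.+1)%:R * ip (L k) (L l) = integ a b (fun x =>
    (legendre a b k)^`().[x] *
    ((legendre_weight a b).[x] * (legendre a b l)^`().[x])).
  rewrite -(integ_legendre_op _ (ltW ab) (AC_horner _ _ _)) legendre_opE//.
  rewrite -integZ; last exact: L2M (LL2 _) (LL2 _).
  by apply: integ_eq => x _; rewrite hornerZ /L; ring.
have : (j * j.+1)%:R * ip (L i) (L j) = (i * i.+1)%:R * ip (L i) (L j).
  rewrite E [in RHS]ipC E; apply: integ_eq => x _; ring.
move/eqP; rewrite -subr_eq0 -mulrBl mulf_eq0 => /orP[|/eqP//].
rewrite subr_eq0 eqr_nat => /eqP H; case/eqP: ij; nia.
Qed.

Local Lemma ip_sum_legendre f m n (c : nat -> R) : L2 a b f ->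
  ip f (horner (\sum_(m <= k < n) c k *: legendre a b k)) =
  \sum_(m <= k < n) c k * ip f (L k).
Proof.
move=> lf; transitivity (integ a b
    (fun x => \sum_(m <= k < n) c k * (f x * L k x))).
  apply: integ_eq => x _; rewrite horner_sum mulr_sumr; apply: eq_bigr => k _.
  by rewrite hornerZ mulrCA.
rewrite integ_sum => [|k]; last exact/L1Z/(L2M lf (LL2 _)).
by apply: eq_bigr => k _; rewrite integZ//; exact: L2M lf (LL2 _).
Qed.

Local Lemma ip_sum_legendre1 m n (c : nat -> R) j :
  ip (L j) (horner (\sum_(m <= k < n) c k *: legendre a b k)) =
  if (m <= j < n)%N then c j * ip (L j) (L j) else 0.
Proof.
rewrite ip_sum_legendre; last exact: LL2.
case: ifPn => [jmn|jmn].
  rewrite (bigD1_seq j) ?mem_index_iota ?iota_uniq//= big1 ?addr0// => k kj.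
  by rewrite ip_legendre ?mulr0// eq_sym.
rewrite big_seq big1// => k; rewrite mem_index_iota => kmn.
by rewrite ip_legendre ?mulr0//; apply: contraNneq jmn => ->.
Qed.

(* If [ip (L k) (L k)] vanished, so would the numerator. *)
Definition legendre_fourier f k : R := ip f (L k) / ip (L k) (L k).

Local Lemma legendre_fourierK f k : L2 a b f ->
  legendre_fourier f k * ip (L k) (L k) = ip f (L k).
Proof.
move=> lf; rewrite /legendre_fourier.
have [E|?] := eqVneq (ip (L k) (L k)) 0; last by rewrite divfK.
rewrite E mulr0; apply/esym/eqP; rewrite -sqrf_eq0 eq_le sqr_ge0 andbT.
have := integ_CS lf (LL2 k); rewrite -/(ip f (L k)).
have -> : integ a b (fun x => L k x ^+ 2) = ip (L k) (L k) by [].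
by rewrite E mulr0.
Qed.

Definition legendre_proj f n : {poly R} :=
  \sum_(0 <= k < n) legendre_fourier f k *: legendre a b k.

Lemma size_legendre_sum m n (c : nat -> R) :
  (size (\sum_(m <= k < n) c k *: legendre a b k)%R <= n)%N.
Proof.
rewrite big_seq; elim/big_ind: _ => [|p q pn qn|k].
- by rewrite size_poly0.
- by rewrite (leq_trans (size_polyD _ _))// geq_max pn.
- rewrite mem_index_iota => /andP[_ kn].
  by rewrite (leq_trans (size_scale_leq _ _))// size_legendre.
Qed.

Local Lemma ip_orth_poly f n : L2 a b f -> (forall k, (k < n)%N -> ip f (L k) = 0) ->
  forall q, (size q <= n)%N -> ip f (horner q) = 0.
Proof.
move=> lf f0; apply: (legendre_ind ab) => [|k c q kn IH].
  rewrite /ip (@integ_eq _ _ _ _ (fun x => 0 * f x)) => [|x _].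
    by rewrite integZ ?mul0r//; exact: L2_L1.
  by rewrite horner0; ring.
transitivity (c * ip f (L k) + ip f (horner q)); last first.
  by rewrite IH f0// mulr0 addr0.
have lq := L2_horner a b q.
rewrite -integZ; last exact: L2M lf (LL2 _).
rewrite -integD; [|exact/L1Z/(L2M lf (LL2 _))|exact: L2M lf lq].
by apply: integ_eq => x _; rewrite hornerD hornerZ /L; ring.
Qed.

Lemma legendre_proj_orth f n q : L2 a b f -> (size q <= n)%N ->
  integ a b (fun x => (f x - (legendre_proj f n).[x]) * q.[x]) = 0.
Proof.
move=> lf; have lp := L2_horner a b (legendre_proj f n).
apply: (ip_orth_poly (L2B lf lp)) => k kn.
transitivity (ip f (L k) - ip (L k) (horner (legendre_proj f n))).
  rewrite -integB; [|exact: L2M lf (LL2 _)|exact: L2M (LL2 _) lp].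
  by apply: integ_eq => x _; ring.
by rewrite ip_sum_legendre1 leq0n kn/= legendre_fourierK// subrr.
Qed.

Lemma orth_pythagoras f q n : L2 a b f ->
  (forall q, (size q <= n)%N -> integ a b (fun x => f x * q.[x]) = 0) ->
  (size q <= n)%N ->
  integ a b (fun x => (f x + q.[x]) ^+ 2) =
  integ a b (fun x => f x ^+ 2) + integ a b (fun x => q.[x] ^+ 2).
Proof.
move=> lf f0 qn; have lq := L2_horner a b q.
have lfq := L2M lf lq.
transitivity (integ a b (fun x => f x ^+ 2) + integ a b (fun x => q.[x] ^+ 2) +
  2 * integ a b (fun x => f x * q.[x])); last by rewrite f0// mulr0 addr0.
rewrite -integD; [|exact: lf.2|exact: lq.2].
rewrite -integZ// -integD; [|exact: L1D lf.2 lq.2|exact: L1Z].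
by apply: integ_eq => x _; ring.
Qed.

(* Bessel's inequality for [g] and the derivatives of the Legendre polynomials,
   which are orthogonal for the weight [(x - a) (b - x)]. *)
Lemma legendre_tail f g r n : AC a b f g ->
  (r * r.+1)%:R * integ a b (fun x =>
     (\sum_(r <= k < n) legendre_fourier f k *: legendre a b k).[x] ^+ 2) <=
  (b - a) ^+ 2 * integ a b (fun x => g x ^+ 2).
Proof.
move=> H; have lf := AC_L2 (ltW ab) H; have lg := H.1.
set al := legendre_fourier f; set p := \sum_(_ <= _ < _) _.
set w := legendre_weight a b.
have lp := L2_horner a b p; have lp' := L2_horner a b p^`().
pose h k := ip (L k) (L k).
have h0 k : 0 <= h k by apply: integ_ge0 => x _; exact: sqr_ge0.
have Ap : legendre_op a b p =
    \sum_(r <= k < n) (al k * (k * k.+1)%:R) *: legendre a b k.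
  rewrite /legendre_op /p raddf_sum mulr_sumr raddf_sum/= -sumrN.
  apply: eq_bigr => k _.
  rewrite derivZ -scalerAr derivZ -scalerN -/(legendre_op a b (legendre a b k)).
  by rewrite legendre_opE// scalerA.
have fAp : ip f (horner (legendre_op a b p)) =
    \sum_(r <= k < n) al k ^+ 2 * (k * k.+1)%:R * h k.
  rewrite Ap ip_sum_legendre//; apply: eq_bigr => k _.
  by rewrite -legendre_fourierK// -/(al k) /h; ring.
have pAp : ip (horner p) (horner (legendre_op a b p)) =
    \sum_(r <= k < n) al k ^+ 2 * (k * k.+1)%:R * h k.
  rewrite Ap ip_sum_legendre//; apply: eq_big_nat => k krn.
  by rewrite ipC ip_sum_legendre1 krn /h; ring.
have pp : ip (horner p) (horner p) = \sum_(r <= k < n) al k ^+ 2 * h k.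
  rewrite ip_sum_legendre//; apply: eq_big_nat => k krn.
  by rewrite ipC ip_sum_legendre1 krn /h; ring.
have w0 x : a <= x <= b -> 0 <= w.[x].
  by case/andP=> ax xb; rewrite /w !hornerE mulr_ge0// subr_ge0.
have wh x : a <= x <= b -> w.[x] <= (b - a) ^+ 2.
  case/andP=> ax xb; rewrite /w !hornerE expr2.
  by rewrite ler_pM ?subr_ge0// lerD// lerN2.
have [K K0 wK] := horner_bounded a b w.
have lwg : L2 a b (fun x => w.[x] * g x).
  have mw : measurable_fun (Icc a b) (fun x => w.[x] * g x).
    by apply: measurable_funM; [exact: (L2_horner a b w).1|exact: lg.1].
  split => //; apply: L1_le (L1Z (K ^+ 2) lg.2) _.
    exact: measurable_funM.
  move=> x abx; rewrite normrX normrM exprMn.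
  rewrite (real_normK (num_real (g x))) ler_wpM2r ?sqr_ge0//.
  by rewrite lerXn2r ?nnegrE// wK.
have lwp : L2 a b (fun x => w.[x] * p^`().[x]).
  by apply: L2_eq (L2_horner a b (w * p^`())) => x _; rewrite hornerM.
have wg2 : L1 a b (fun x => w.[x] * g x ^+ 2).
  by apply: L1_eq (L2M lwg lg) => x _; ring.
(* Expand the weighted square of [g - p']. After integration by parts its cross term and its last
   term are [-2] and [1] times the sum on the left. *)
have bessel : \sum_(r <= k < n) al k ^+ 2 * (k * k.+1)%:R * h k <=
    integ a b (fun x => w.[x] * g x ^+ 2).
  have : 0 <= integ a b (fun x => w.[x] * (g x - p^`().[x]) ^+ 2).
    by apply: integ_ge0 => x abx; rewrite mulr_ge0 ?sqr_ge0 ?w0.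
  rewrite (_ : integ _ _ _ = integ a b (fun x => w.[x] * g x ^+ 2)
     - 2 * ip f (horner (legendre_op a b p))
     + ip (horner p) (horner (legendre_op a b p))).
    rewrite fAp pAp; lra.
  rewrite /ip (integ_legendre_op _ (ltW ab) H).
  rewrite (integ_legendre_op _ (ltW ab) (AC_horner a b p)) -/w.
  have l1 := L2M lg lwp; have l2 := L2M lp' lwp.
  rewrite -integZ// -integB//; last exact: L1Z.
  rewrite -integD//; last by apply: L1B => //; exact: L1Z.
  by apply: integ_eq => x _; ring.
have -> : integ a b (fun x => p.[x] ^+ 2) = ip (horner p) (horner p) by [].
rewrite pp; apply: (@le_trans _ _ (integ a b (fun x => w.[x] * g x ^+ 2))).
  (* On the range of summation the eigenvalues are at least [r (r + 1)]. *)
  apply: le_trans bessel; rewrite mulr_sumr; apply: ler_sum_nat => k /andP[rk _].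
  rewrite mulrCA mulrA ler_wpM2r// ler_wpM2l ?sqr_ge0// ler_nat leq_mul//.
rewrite -integZ; last exact: lg.2.
apply: integ_le => //; first exact/L1Z/lg.2.
by move=> x abx; rewrite ler_wpM2r ?sqr_ge0// wh.
Qed.

(** If [q] approximates [f] within [e], the Legendre sum of order [n >= size q] is at least as good
    in [L2]. So up to an arbitrarily small term the error is a finite Legendre sum, which
    [legendre_tail] bounds. *)
Lemma proj_error1 f g p r : AC a b f g -> (size p <= r)%N ->
  (forall q, (size q <= r)%N ->
     integ a b (fun x => (f x - p.[x]) * q.[x]) = 0) ->
  r%:R ^+ 2 * integ a b (fun x => (f x - p.[x]) ^+ 2) <=
  (b - a) ^+ 2 * integ a b (fun x => g x ^+ 2).
Proof.
move=> H pr fp; have lf := AC_L2 (ltW ab) H.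
have lfp : L2 a b (fun x => f x - p.[x]) := L2B lf (L2_horner a b p).
apply/ler_addgt0Pr => d d0.
pose K : R := (r%:R ^+ 2) * (b - a).
have ba0 : 0 <= b - a by rewrite subr_ge0 ltW.
have K0 : 0 <= K by rewrite mulr_ge0 ?sqr_ge0.
(* The bound by [1] gives [e^2 <= e], whence [K e^2 <= d]. *)
pose e := Num.min 1 (d / (K + 1)).
have K1 : 0 < K + 1 by rewrite ltr_wpDl.
have e0 : 0 < e by rewrite lt_min ltr01 divr_gt0.
have [q fq] := weierstrass_AC ab H e0.
pose n := maxn (size q) r.
have lfn := L2B lf (L2_horner a b (legendre_proj f n)).
pose t := \sum_(r <= k < n) legendre_fourier f k *: legendre a b k.
have projE : legendre_proj f n = legendre_proj f r + t.
  by rewrite /legendre_proj (big_cat_nat _ (n := r))// leq_maxr.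
(* Best approximation by [p]: enough to pass to the Legendre projection without uniqueness of the
   projection. *)
have h1 : integ a b (fun x => (f x - p.[x]) ^+ 2) <=
    integ a b (fun x => (f x - (legendre_proj f r).[x]) ^+ 2).
  rewrite [leRHS](_ : _ = integ a b (fun x =>
      ((f x - p.[x]) + (p - legendre_proj f r).[x]) ^+ 2)); last first.
    by apply: integ_eq => x _; rewrite hornerD hornerN; ring.
  rewrite (orth_pythagoras (n := r)) ?lerDl//.
    by apply: integ_ge0 => x _; exact: sqr_ge0.
  rewrite (leq_trans (size_polyD _ _))// geq_max pr size_polyN.
  exact: size_legendre_sum.
have h2 : integ a b (fun x => (f x - (legendre_proj f r).[x]) ^+ 2) =
    integ a b (fun x => (f x - (legendre_proj f n).[x]) ^+ 2) +
    integ a b (fun x => t.[x] ^+ 2).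
  rewrite -(orth_pythagoras (n := n))//; last exact: size_legendre_sum.
  - by apply: integ_eq => x _; rewrite projE hornerD; ring.
  - by move=> q' qn'; exact: legendre_proj_orth.
have h3 : integ a b (fun x => (f x - (legendre_proj f n).[x]) ^+ 2) <=
    e ^+ 2 * (b - a).
  apply: (@le_trans _ _ (integ a b (fun x => (f x - q.[x]) ^+ 2))).
    rewrite [leRHS](_ : _ = integ a b (fun x =>
      ((f x - (legendre_proj f n).[x]) + (legendre_proj f n - q).[x]) ^+ 2)).
      rewrite (orth_pythagoras (n := n)) ?lerDl//.
      - by apply: integ_ge0 => x _; exact: sqr_ge0.
      - by move=> q' qn'; exact: legendre_proj_orth.
      - rewrite (leq_trans (size_polyD _ _))// geq_max size_polyN leq_maxl andbT.
        exact: size_legendre_sum.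
    by apply: integ_eq => x _; rewrite hornerD hornerN; ring.
  rewrite -integ_cst ?(ltW ab)//; apply: integ_le.
  - exact: (L2B lf (L2_horner a b q)).2.
  - exact: L1_cst.
  - move=> x abx; rewrite -real_normK ?num_real// lerXn2r ?nnegrE//.
    + exact: ltW.
    + exact: fq.
have h4 := legendre_tail r n H; rewrite -/t in h4.
set X := integ a b (fun x => t.[x] ^+ 2) in h2 h4.
have X0 : 0 <= X by apply: integ_ge0 => x _; exact: sqr_ge0.
have r2 : 0 <= r%:R ^+ 2 :> R by exact: sqr_ge0.
apply: (le_trans (ler_wpM2l r2 (le_trans h1 (eq_ind _ (fun z => z <= _ + X)
  (lerD h3 (lexx X)) _ (esym h2))))).
rewrite mulrDr addrC lerD//.
  by apply: le_trans h4; rewrite ler_wpM2r// -natrX ler_nat -mulnn leq_mul.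
have e2 : e ^+ 2 <= e.
  by rewrite expr2 -[leRHS]mulr1 ler_wpM2l ?(ltW e0)// ge_min lexx.
have ed : e * (K + 1) <= d by rewrite -ler_pdivlMr// ge_min lexx orbT.
have -> : r%:R ^+ 2 * (e ^+ 2 * (b - a)) = K * e ^+ 2 by rewrite /K; ring.
apply: (le_trans (ler_wpM2l K0 e2)); lra.
Qed.

End Projection.

Lemma poly_antideriv (p : {poly R}) :
  exists2 q, q^`() = p & (size q <= (size p).+1)%N.
Proof.
exists (\poly_(i < (size p).+1) (p`_i.-1 / i%:R)); last exact: size_poly.
apply/polyP => i; rewrite coef_deriv coef_poly ltnS.
case: ltnP => [ip|pi]; last by rewrite mul0rn nth_default.
by rewrite -[LHS]mulr_natr divfK// pnatr_eq0.
Qed.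

(** Changing [G 0] by a polynomial of size at most [r] leaves its projection error unchanged. With a
    primitive of the projection of [G 1] at level [r - 1], the derivative that [proj_error1] sees is
    itself a projection error, one level lower; hence the factors [1 / (r - i)]. *)
Lemma proj_error a b (G : nat -> R -> R) p r s : a < b -> (s <= r)%N ->
  L2 a b (G 0%N) -> (forall j, (j < s)%N -> AC a b (G j) (G j.+1)) ->
  (size p <= r)%N ->
  (forall q, (size q <= r)%N ->
     integ a b (fun x => (G 0%N x - p.[x]) * q.[x]) = 0) ->
  integ a b (fun x => (G 0%N x - p.[x]) ^+ 2) <=
  (\prod_(i < s) ((b - a) / (r - i)%:R)) ^+ 2 *
  integ a b (fun x => G s x ^+ 2).
Proof.
move=> ab; elim: s G p r => [|s IH] G p r sr lG GAC pr Gp.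
  rewrite big_ord0 expr1n mul1r.
  rewrite [leRHS](_ : _ = integ a b (fun x => ((G 0%N x - p.[x]) + p.[x]) ^+ 2)).
    rewrite (orth_pythagoras (n := r)) ?lerDl//.
      by apply: integ_ge0 => x _; exact: sqr_ge0.
    exact: L2B lG (L2_horner a b p).
  by apply: integ_eq => x _; rewrite subrK.
have r0 : (0 < r)%N := leq_ltn_trans (leq0n _) sr.
have lG1 : L2 a b (G 1%N) := (GAC 0%N isT).1.
(* Level [r - 1], so that a primitive of [p1] still has size at most [r]. *)
pose p1 := legendre_proj a b (G 1%N) r.-1.
have [P P' sP] := poly_antideriv p1.
have sp1 : (size p1 <= r.-1)%N by exact: size_legendre_sum.
have sPr : (size P <= r)%N.
  by rewrite (leq_trans sP)// -(prednK r0) ltnS.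
have H1 := ACB (GAC 0%N isT) (AC_horner a b P); rewrite P' in H1.
have := proj_error1 (p := p - P) (r := r) ab H1.
have e1 x : G 0%N x - P.[x] - (p - P).[x] = G 0%N x - p.[x].
  by rewrite hornerD hornerN; ring.
have -> : integ a b (fun x => (G 0%N x - P.[x] - (p - P).[x]) ^+ 2) =
    integ a b (fun x => (G 0%N x - p.[x]) ^+ 2).
  by apply: integ_eq => x _; rewrite e1.
have Porth q : (size q <= r)%N ->
    integ a b (fun x => (G 0%N x - P.[x] - (p - P).[x]) * q.[x]) = 0.
  by move=> qr; rewrite -[RHS](Gp q qr); apply: integ_eq => x _; rewrite e1.
have szpP : (size (p - P)%R <= r)%N.
  by rewrite (leq_trans (size_polyD _ _))// geq_max pr size_polyN.
move=> /(_ szpP Porth) h1.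
have h2 : integ a b (fun x => (G 1%N x - p1.[x]) ^+ 2) <=
    (\prod_(i < s) ((b - a) / (r.-1 - i)%:R)) ^+ 2 *
    integ a b (fun x => G s.+1 x ^+ 2).
  apply: (IH (fun j => G j.+1)) => //.
  - by rewrite -ltnS prednK.
  - by move=> j js; exact: GAC.
  - by move=> q qr; exact: legendre_proj_orth.
have r2 : 0 < r%:R ^+ 2 :> R by rewrite exprn_gt0// ltr0n.
rewrite big_ord_recl subn0 exprMn -mulrA exprMn exprVn mulrAC.
rewrite ler_pdivlMr// mulrC; apply: (le_trans h1).
rewrite ler_wpM2l ?sqr_ge0//.
rewrite (eq_bigr (fun i : 'I_s => (b - a) / (r.-1 - i)%:R))// => i _.
by congr (_ / _%:R); rewrite /= /bump leq0n add1n; lia.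
Qed.

End Legendre.

(** * Euclidean inner product and operator norm *)

Section EuclideanSpace.
Context {R : realType} {M : nat}.
Implicit Types (u v w : 'cV[R]_M).

Definition dot u v : R := \sum_i u i 0 * v i 0.

Lemma dotC u v : dot u v = dot v u.
Proof. by apply: eq_bigr => i _; rewrite mulrC. Qed.

Lemma dotDl u v w : dot (u + v) w = dot u w + dot v w.
Proof. by rewrite -big_split; apply: eq_bigr => i _; rewrite mxE mulrDl. Qed.

Lemma dotZl k u v : dot (k *: u) v = k * dot u v.
Proof. by rewrite mulr_sumr; apply: eq_bigr => i _; rewrite mxE mulrA. Qed.

Lemma dotDr u v w : dot u (v + w) = dot u v + dot u w.
Proof. by rewrite dotC dotDl !(dotC _ u). Qed.

Lemma dotZr k u v : dot u (k *: v) = k * dot u v.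
Proof. by rewrite dotC dotZl dotC. Qed.

Lemma dotBr u v w : dot u (v - w) = dot u v - dot u w.
Proof. by rewrite dotDr -scaleN1r dotZr mulN1r. Qed.

Lemma dot_suml n (F : 'I_n -> 'cV[R]_M) v :
  dot (\sum_(k < n) F k) v = \sum_(k < n) dot (F k) v.
Proof.
apply: (big_morph (dot^~ v)) => [x y|]; first exact: dotDl.
by rewrite -(scale0r 0) dotZl mul0r.
Qed.

Lemma dot_ge0 u : 0 <= dot u u.
Proof. by apply: sumr_ge0 => i _; rewrite -expr2 sqr_ge0. Qed.

Lemma enormE u : enorm u = Num.sqrt (dot u u).
Proof. by congr Num.sqrt; apply: eq_bigr => i _; rewrite expr2. Qed.

Lemma enorm_ge0 u : 0 <= enorm u. Proof. exact: sqrtr_ge0. Qed.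

Lemma sqr_enorm u : enorm u ^+ 2 = dot u u.
Proof. by rewrite enormE sqr_sqrtr// dot_ge0. Qed.

Lemma dot_CS u v : dot u v ^+ 2 <= dot u u * dot v v.
Proof.
have H s t : 0 <= s ^+ 2 * dot u u + (t ^+ 2 * dot v v + 2 * s * t * dot u v).
  have := dot_ge0 (s *: u + t *: v).
  by rewrite dotDl !dotDr !dotZl !dotZr (dotC v u); congr (0 <= _); ring.
have u0 := dot_ge0 u; have v0 := dot_ge0 v.
have [v00|v0'] := eqVneq (dot v v) 0.
  suff -> : dot u v = 0 by rewrite expr0n/= mulr_ge0.
  apply/eqP; apply: contraT => X0.
  have := H 1 (- (dot u u + 1) / (2 * dot u v)); rewrite v00.
  rewrite mulr0 add0r expr1n !mul1r mulr1.
  have -> : 2 * (- (dot u u + 1) / (2 * dot u v)) * dot u v = - (dot u u + 1).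
    by field.
  lra.
have := H (dot v v) (- dot u v).
rewrite (_ : _ + _ = dot v v * (dot u u * dot v v - dot u v ^+ 2)); last by ring.
by rewrite pmulr_rge0 ?lt_neqAle ?v0 1?eq_sym ?v0'// subr_ge0.
Qed.

Lemma enormD u v : enorm (u + v) <= enorm u + enorm v.
Proof.
rewrite -(ler_pXn2r (isT : (0 < 2)%N)) ?nnegrE ?addr_ge0 ?enorm_ge0//.
rewrite sqrrD !sqr_enorm dotDl !dotDr (dotC v u).
have : dot u v <= enorm u * enorm v.
  rewrite (le_trans (ler_norm _))// -sqrtr_sqr !enormE -sqrtrM ?dot_ge0//.
  exact/ler_wsqrtr/dot_CS.
lra.
Qed.

Lemma enormZ k u : enorm (k *: u) = `|k| * enorm u.
Proof.
by rewrite !enormE dotZl dotZr mulrA -expr2 sqrtrM ?sqr_ge0// sqrtr_sqr.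
Qed.

Lemma enorm_le_sum u : enorm u <= \sum_i `|u i 0|.
Proof.
have S0 (P : pred 'I_M) : 0 <= \sum_(i | P i) `|u i 0| by exact: sumr_ge0.
rewrite -(ler_pXn2r (isT : (0 < 2)%N)) ?nnegrE ?S0 ?enorm_ge0//.
rewrite sqr_enorm expr2 mulr_suml; apply: ler_sum => i _.
rewrite -expr2 -real_normK ?num_real// expr2 ler_wpM2l//.
by rewrite (bigD1 i)//= lerDl.
Qed.

Lemma abs_le_enorm u i : `|u i 0| <= enorm u.
Proof.
rewrite enormE -sqrtr_sqr; apply: ler_wsqrtr.
rewrite /dot (bigD1 i)//= -expr2 lerDl; apply: sumr_ge0 => j _.
by rewrite -expr2 sqr_ge0.
Qed.

Lemma enorm_eq0 u : enorm u = 0 -> u = 0.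
Proof.
move=> u0; apply/colP => i; rewrite mxE; apply/eqP.
by rewrite -normr_le0 -u0 abs_le_enorm.
Qed.

(** Needed for [sup] to be a true supremum and not its default value. *)
Lemma opnorm_ubound (D : 'M[R]_M) :
  has_ubound [set enorm (D *m x) | x in [set x : 'cV[R]_M | enorm x = 1]].
Proof.
exists (\sum_(i < M) \sum_(j < M) `|D i j|) => _ [x /= x1 <-].
apply: (le_trans (enorm_le_sum _)); apply: ler_sum => i _.
rewrite mxE (le_trans (ler_norm_sum _ _ _))//; apply: ler_sum => j _.
by rewrite normrM -[leRHS]mulr1 ler_wpM2l// -x1 abs_le_enorm.
Qed.

Lemma opnorm_ge0 (D : 'M[R]_M) : 0 <= opnorm D.
Proof.
(* For [M = 0] there is no unit vector, and [sup set0] is [0]. *)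
have [E|/set0P[_ [x x1 _]]] :=
    eqVneq [set enorm (D *m x) | x in [set x : 'cV[R]_M | enorm x = 1]] set0.
  by rewrite /opnorm E sup0.
apply: (le_trans (enorm_ge0 (D *m x))); apply: (ub_le_sup (opnorm_ubound D)).
by exists x.
Qed.

Lemma enorm_mulmx (D : 'M[R]_M) x : enorm (D *m x) <= opnorm D * enorm x.
Proof.
have [x0|x0] := eqVneq (enorm x) 0.
  rewrite (enorm_eq0 x0) mulmx0 enormE.
  by rewrite -(scale0r 0) dotZl mul0r sqrtr0 mulr_ge0 ?opnorm_ge0 ?enorm_ge0.
have xp : 0 < enorm x by rewrite lt_neqAle eq_sym x0 enorm_ge0.
rewrite -ler_pdivrMr// mulrC.
have -> : (enorm x)^-1 * enorm (D *m x) = enorm (D *m ((enorm x)^-1 *: x)).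
  by rewrite -scalemxAr enormZ ger0_norm// invr_ge0 ltW.
apply: (ub_le_sup (opnorm_ubound D)); exists ((enorm x)^-1 *: x) => //=.
by rewrite enormZ ger0_norm ?invr_ge0 ?(ltW xp)// mulVf.
Qed.

End EuclideanSpace.

(** * Alternating sums *)

Section AlternatingSums.
Context {R : realType}.
Implicit Types be : nat -> R.

Definition altsum n be : R := \sum_(i < n) (-1) ^+ i * be i.

Lemma altsumS n be : altsum n.+1 be = be 0%N - altsum n (fun i => be i.+1).
Proof.
rewrite /altsum big_ord_recl expr0 mul1r -sumrN; congr (_ + _).
by apply: eq_bigr => i _; rewrite lift0 exprS mulN1r mulNr.
Qed.

(** Leibniz's criterion for a finite sum. *)
Lemma altsum_bounds n be : (forall i, 0 <= be i) ->
  (forall i, be i.+1 <= be i) -> 0 <= altsum n be <= be 0%N.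
Proof.
elim: n be => [|n IH] be b0 bS; first by rewrite /altsum big_ord0 lexx b0.
have /andP[h1 h2] := IH (fun i => be i.+1) (fun i => b0 _) (fun i => bS _).
rewrite altsumS lerBlDr lerDl h1 andbT subr_ge0.
exact: le_trans (bS 0%N).
Qed.

(** The first two terms stay explicit: the CFL bounds for [r = 1, 2 mod 4] come from them, and
    Leibniz's criterion disposes of the rest. *)
Lemma altsum_ge n be : (forall i, 0 <= be i) ->
  (forall i, (2 <= i)%N -> be i.+1 <= be i) ->
  be 0%N - be 1%N <= altsum n.+2 be.
Proof.
move=> b0 bS; rewrite !altsumS opprB addrA addrAC lerDl.
by have /andP[] := @altsum_bounds n (fun i => be i.+2) (fun i => b0 _)
  (fun i => bS i.+2 isT).
Qed.

Lemma sum_even n (F : nat -> R) : (forall i, F i.*2.+1 = 0) ->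
  \sum_(k < n.*2) F k = \sum_(i < n) F i.*2.
Proof.
move=> F0; elim: n => [|n IH]; first by rewrite !big_ord0.
by rewrite doubleS !big_ord_recr /= IH F0 addr0.
Qed.

Lemma sum_odd n (F : nat -> R) : (forall i, F i.*2 = 0) ->
  \sum_(k < n.*2) F k = \sum_(i < n) F i.*2.+1.
Proof.
move=> F0; elim: n => [|n IH]; first by rewrite !big_ord0.
by rewrite doubleS !big_ord_recr /= IH F0 addr0.
Qed.

End AlternatingSums.

(** * The amplification polynomial of a skew-symmetric matrix *)

Section Amplification.
Context {R : realType} {M : nat} (D : 'M[R]_M).
Hypothesis Dskew : D + D^T = 0.
Implicit Types (u v : 'cV[R]_M) (r n : nat) (c s L g : R).

Definition mpow v n : 'cV[R]_M := iter n (mulmx D) v.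

Definition amp_coef r c k : R :=
  if (k <= r)%N then k`!%:R^-1 else if k == r.+1 then c / k`!%:R else 0.

(* [amp r c s v] is [P(s D) v], for the polynomial [P] of the header. *)
Definition amp r c s v : 'cV[R]_M :=
  \sum_(k < r.+2) (amp_coef r c k * s ^+ k) *: mpow v k.

Lemma mpowS v n : mpow v n.+1 = D *m mpow v n. Proof. by []. Qed.

Lemma dot_skew u v : dot (D *m u) v = - dot u (D *m v).
Proof.
have DT : D^T = - D by rewrite -[LHS](addKr D) Dskew addr0.
transitivity (\sum_i \sum_j D i j * u j 0 * v i 0).
  by apply: eq_bigr => i _; rewrite mxE mulr_suml.
rewrite exchange_big/= -sumrN; apply: eq_bigr => j _.
rewrite mxE -mulrN -sumrN mulr_sumr; apply: eq_bigr => i _.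
by have /matrixP/(_ j i) := DT; rewrite !mxE => ->; ring.
Qed.

Lemma dot_mpow v i j : dot (mpow v i) (mpow v j) =
  (-1) ^+ i * dot v (mpow v (i + j)).
Proof.
elim: i j => [|i IH] j; first by rewrite mul1r.
by rewrite mpowS dot_skew -mpowS IH exprS mulN1r mulNr addnS addSn.
Qed.

Lemma dot_mpow_odd v n : odd n -> dot v (mpow v n) = 0.
Proof.
move=> on; have := dot_mpow v n 0; rewrite dotC addn0 -signr_odd on expr1.
by move=> /= E; lra.
Qed.

Definition sqpow v n : R := dot (mpow v n) (mpow v n).

Lemma dot_mpow_even v n : dot v (mpow v n.*2) = (-1) ^+ n * sqpow v n.
Proof.
by rewrite /sqpow dot_mpow addnn mulrA -exprD addnn -signr_odd odd_double mul1r.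
Qed.

Lemma sqpow_ge0 v n : 0 <= sqpow v n. Proof. exact: dot_ge0. Qed.

(** The number [n] of terms is free, the extra coefficients being zero, so that it can be even when
    the sum is split by parity. *)
Lemma dot_amp r c s v j n : (r.+2 <= n)%N ->
  dot (amp r c s v) (mpow v j) =
  \sum_(k < n) amp_coef r c k * s ^+ k * ((-1) ^+ k * dot v (mpow v (k + j))).
Proof.
move=> rn; rewrite /amp dot_suml.
rewrite (big_ord_widen_cond n predT (fun k =>
  dot ((amp_coef r c k * s ^+ k) *: mpow v k) (mpow v j)))//.
rewrite big_mkcond; apply: eq_bigr => k _ /=.
rewrite dotZl dot_mpow; case: ltnP => // rk.
by rewrite /amp_coef leqNgt (ltn_trans _ rk)// gtn_eqF// !mul0r.
Qed.

(** By skew-symmetry the odd powers drop out, and each even power [2 m] contributes [(-1)^m] times a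
    squared norm. *)
Lemma dot_amp_even r c s v j n : (r.+2 <= n.*2)%N ->
  dot (amp r c s v) (mpow v j.*2) = (-1) ^+ j *
  altsum n (fun i => amp_coef r c i.*2 * s ^+ i.*2 * sqpow v (i + j)).
Proof.
move=> rn; rewrite (dot_amp _ _ _ _ rn).
rewrite (@sum_even _ n (fun k => amp_coef r c k * s ^+ k *
  ((-1) ^+ k * dot v (mpow v (k + j.*2))))) => [|i]; last first.
  by rewrite dot_mpow_odd ?mulr0//= oddD /= !odd_double.
rewrite /altsum mulr_sumr; apply: eq_bigr => i _.
rewrite -doubleD dot_mpow_even -(signr_odd _ i.*2) odd_double mul1r exprD.
by ring.
Qed.

Lemma dot_amp_odd r c s v j n : (r.+2 <= n.*2)%N ->
  dot (amp r c s v) (mpow v j.*2.+1) = (-1) ^+ j *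
  altsum n (fun i => amp_coef r c i.*2.+1 * s ^+ i.*2.+1 * sqpow v (i + j).+1).
Proof.
move=> rn; rewrite (dot_amp _ _ _ _ rn).
rewrite (@sum_odd _ n (fun k => amp_coef r c k * s ^+ k *
  ((-1) ^+ k * dot v (mpow v (k + j.*2.+1))))) => [|i]; last first.
  by rewrite dot_mpow_odd ?mulr0//= oddD /= !odd_double.
rewrite /altsum mulr_sumr; apply: eq_bigr => i _.
rewrite addSn addnS -doubleD -doubleS dot_mpow_even.
rewrite -(signr_odd _ i.*2.+1) /= odd_double expr1 !exprS exprD.
by ring.
Qed.

Lemma horner_nincr (p : {poly R}) S : 0 <= S ->
  (forall x, 0 <= x <= S -> p^`().[x] <= 0) -> p.[S] <= p.[0].
Proof.
move=> S0 p0; have [_ /(_ S)] := AC_horner 0 S p.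
rewrite S0 lexx => /(_ isT) ->; rewrite gerDl.
have := integ_le (L2_L1 (L2_horner 0 S p^`())) (L1_cst 0 S 0) p0.
by rewrite integ_cst// mul0r.
Qed.

(* The derivative of [|amp s v|^2] only involves the defect [D amp - amp'],
   since [dot u (D u) = 0]. *)
Lemma amp_contract r c S v : 0 <= S ->
  (forall s, 0 <= s <= S ->
     0 <= (1 - c) * dot (amp r c s v) (mpow v r.+1) +
          c / r.+1%:R * s * dot (amp r c s v) (mpow v r.+2)) ->
  enorm (amp r c S v) <= enorm v.
Proof.
move=> S0 Hs.
pose up i : {poly R} :=
  \sum_(k < r.+2) (amp_coef r c k * mpow v k i 0) *: 'X^k.
have upE i s : (up i).[s] = amp r c s v i 0.
  rewrite /up /amp horner_sum summxE; apply: eq_bigr => k _.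
  by rewrite hornerZ hornerXn mxE; ring.
pose phi := \sum_(i < M) up i ^+ 2.
have phiE s : phi.[s] = dot (amp r c s v) (amp r c s v).
  rewrite /phi horner_sum; apply: eq_bigr => i _.
  by rewrite horner_exp upE expr2.
have fac n : (n`!%:R : R) != 0 by rewrite pnatr_eq0 -lt0n fact_gt0.
(* Below degree [r] the Taylor coefficients cancel between [D amp] and [amp']. At [D^(r+1)] they
   have coefficients [1 / r!] and [c / r!], and [D^(r+2)] occurs only in [D amp]. *)
have upD i s : (up i)^`().[s] = (D *m amp r c s v) i 0 -
    s ^+ r / r`!%:R * ((1 - c) * mpow v r.+1 i 0 +
                        c / r.+1%:R * s * mpow v r.+2 i 0).
  have -> : (D *m amp r c s v) i 0 =
      \sum_(k < r.+2) amp_coef r c k * s ^+ k * mpow v k.+1 i 0.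
    rewrite /amp mulmx_sumr summxE; apply: eq_bigr => k _.
    by rewrite -scalemxAr mxE mpowS.
  rewrite /up raddf_sum horner_sum big_ord_recl/= derivZ derivXn hornerZ mulr0n.
  rewrite horner0 mulr0 add0r [in RHS]big_ord_recr [in RHS]big_ord_recr/=.
  rewrite [in LHS]big_ord_recr /=.
  have -> : \sum_(i0 < r) ((amp_coef r c (bump 0 i0) *
       mpow v (bump 0 i0) i 0) *: 'X^(bump 0 i0))^`().[s] =
     \sum_(k < r) amp_coef r c k * s ^+ k * mpow v k.+1 i 0.
    apply: eq_bigr => k _; rewrite /bump leq0n add1n derivZ derivXn hornerZ.
    rewrite hornerMn hornerXn /= /amp_coef (ltn_ord k) (ltnW (ltn_ord k)).
    rewrite factS natrM -[s ^+ k *+ k.+1]mulr_natr.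
    have A0 : k.+1%:R != 0 :> R by rewrite pnatr_eq0.
    rewrite invfM; set A := k.+1%:R in A0 *; set B := k`!%:R.
    transitivity (A^-1 * A * (B^-1 * s ^+ k * mpow v k.+1 i 0)); first by ring.
    by rewrite mulVf// mul1r.
  rewrite /bump leq0n add1n derivZ derivXn hornerZ hornerMn hornerXn /=.
  rewrite /amp_coef leqnn ltnn eqxx factS natrM -[s ^+ r *+ r.+1]mulr_natr.
  have A0 : r.+1%:R != 0 :> R by rewrite pnatr_eq0.
  rewrite invfM exprS; set A := r.+1%:R in A0 *; set B := r`!%:R.
  set T := \sum_(k < r) _; rewrite add0n.
  transitivity (T + A^-1 * A * (c / B * s ^+ r * (D *m mpow v r) i 0)).
    by ring.
  by rewrite mulVf// mul1r; ring.
have phiD s : phi^`().[s] = - 2 * (s ^+ r / r`!%:R) *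
    ((1 - c) * dot (amp r c s v) (mpow v r.+1) +
          c / r.+1%:R * s * dot (amp r c s v) (mpow v r.+2)).
  transitivity (2 * dot (amp r c s v) (D *m amp r c s v -
     (s ^+ r / r`!%:R) *: ((1 - c) *: mpow v r.+1 +
                        (c / r.+1%:R * s) *: mpow v r.+2))).
    rewrite /phi raddf_sum horner_sum mulr_sumr; apply: eq_bigr => i _ /=.
    by rewrite expr2 derivM hornerD !hornerM upD upE !mxE; ring.
  have : dot (amp r c s v) (D *m amp r c s v) = 0.
    have := dot_skew (amp r c s v) (amp r c s v); rewrite dotC; lra.
  by rewrite dotBr dotZr dotDr !dotZr => ->; ring.
rewrite !enormE; apply: ler_wsqrtr; rewrite -phiE.
have -> : dot v v = phi.[0].
  rewrite phiE /amp big_ord_recl big1 => [|k _]; last first.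
    by rewrite /bump expr0n /= mulr0 scale0r.
  by rewrite /amp_coef /= fact0 invr1 expr0 mulr1 scale1r addr0.
apply: horner_nincr => // s s0S; rewrite phiD mulNr mulNr oppr_le0.
rewrite mulr_ge0 ?Hs// mulr_ge0// divr_ge0// exprn_ge0//.
by case/andP: s0S.
Qed.

End Amplification.

(** * Contractivity under the CFL condition *)

Section Stability.
Context {R : realType} {M : nat} (D : 'M[R]_M).
Hypothesis Dskew : D + D^T = 0.
Implicit Types (u v : 'cV[R]_M) (r n : nat) (c s L g : R).

(** The value of [c] produced by the scheme. It is [0] when the factors [gam r g m] vanish, and the
    amplification polynomial is then the plain Taylor polynomial. *)
Definition damping r g : R :=
  if (r %% 4 == 0)%N || (r %% 4 == 3)%N then 0 else (r%:R + 1) / (r%:R + g).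

Lemma amp_coef_ge0 r c k : 0 <= c -> 0 <= amp_coef r c k.
Proof.
by move=> c0; rewrite /amp_coef; do 2?case: ifP => // _; rewrite ?invr_ge0 ?divr_ge0.
Qed.

(** Taylor coefficients satisfy this with equality for [K = 1]; [K] makes room for the modified top
    coefficient. *)
Lemma amp_coefSS r c k K : 1 <= K -> 0 <= c <= K ->
  amp_coef r c k.+2 * (k.+1 * k.+2)%:R <= K * amp_coef r c k.
Proof.
move=> K1 /andP[c0 cK]; have K0 : 0 <= K by exact: le_trans K1.
have fk : 0 < (k`!%:R : R) by rewrite ltr0n fact_gt0.
have ffk : k.+2`!%:R = (k.+1 * k.+2)%:R * k`!%:R :> R.
  by rewrite !factS -natrM; congr _%:R; lia.
have k12 : (k.+1 * k.+2)%:R != 0 :> R by rewrite pnatr_eq0.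
rewrite {1}/amp_coef; case: ifPn => [kr|kr].
  rewrite /amp_coef (ltnW (ltnW kr)) ffk invfM mulrAC mulVf// mul1r.
  by rewrite -[leLHS]mul1r ler_wpM2r// invr_ge0 ltW.
case: ifPn => [/eqP kr1|kr1]; last first.
  by rewrite mul0r mulr_ge0// amp_coef_ge0.
have -> : amp_coef r c k = k`!%:R^-1.
  by rewrite /amp_coef ifT//; lia.
have -> : c / k.+2`!%:R * (k.+1 * k.+2)%:R = c / k`!%:R.
  by rewrite ffk invfM [_^-1 * _^-1]mulrC mulrA divfK.
by rewrite ler_wpM2r// invr_ge0 ltW.
Qed.

Lemma amp_term_decr r c s L v k n K : 1 <= K -> 0 <= c <= K -> 0 <= s ->
  (forall n, sqpow D v n.+1 <= L ^+ 2 * sqpow D v n) ->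
  K * (s * L) ^+ 2 <= (k.+1 * k.+2)%:R ->
  amp_coef r c k.+2 * s ^+ k.+2 * sqpow D v n.+1 <=
  amp_coef r c k * s ^+ k * sqpow D v n.
Proof.
move=> K1 cK s0 vS sL; have K0 : 0 < K by exact: lt_le_trans K1.
have c0 : 0 <= c by case/andP: cK.
have p0 := amp_coef_ge0 r k c0; have p2 := amp_coef_ge0 r k.+2 c0.
have vn := sqpow_ge0 D v n.
have sk : 0 <= s ^+ k by exact: exprn_ge0.
rewrite -(ler_pM2l K0); apply: (@le_trans _ _
  (amp_coef r c k.+2 * (K * (s * L) ^+ 2) * (s ^+ k * sqpow D v n))).
  have -> : K * (amp_coef r c k.+2 * s ^+ k.+2 * sqpow D v n.+1) =
    K * (amp_coef r c k.+2 * s ^+ k.+2) * sqpow D v n.+1 by ring.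
  have -> : amp_coef r c k.+2 * (K * (s * L) ^+ 2) * (s ^+ k * sqpow D v n) =
    K * (amp_coef r c k.+2 * s ^+ k.+2) * (L ^+ 2 * sqpow D v n).
    by rewrite -[k.+2]addn2 exprD; ring.
  by rewrite ler_wpM2l// mulr_ge0 ?(ltW K0)// mulr_ge0// exprn_ge0.
have -> : K * (amp_coef r c k * s ^+ k * sqpow D v n) =
  K * amp_coef r c k * (s ^+ k * sqpow D v n) by ring.
rewrite ler_wpM2r ?mulr_ge0// (le_trans _ (amp_coefSS _ _ K1 cK))//.
by rewrite ler_wpM2l.
Qed.

Lemma sqpowS v L : 0 <= L -> (forall x, enorm (D *m x) <= L * enorm x) ->
  forall n, sqpow D v n.+1 <= L ^+ 2 * sqpow D v n.
Proof.
move=> L0 DL n; rewrite /sqpow -!sqr_enorm -exprMn lerXn2r ?nnegrE//.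
- exact: enorm_ge0.
- by rewrite mulr_ge0// enorm_ge0.
- exact: DL.
Qed.

Lemma sqr_le_of_le_sqrt (y z : R) : 0 <= z -> 0 <= y -> y <= Num.sqrt z ->
  y ^+ 2 <= z.
Proof. by move=> z0 y0 yz; rewrite -(sqr_sqrtr z0) lerXn2r ?nnegrE ?sqrtr_ge0. Qed.

Lemma sqr_lam_le r g y : 0 < g < 1 -> (0 < r)%N -> 0 <= y -> y <= lam r g ->
  [/\ (r %% 4 = 0)%N -> y ^+ 2 <= 6,
      (r %% 4 = 1)%N -> if r == 1%N then 2 * y ^+ 2 <= 1 - g ^+ 2
                        else y ^+ 2 * (3 - g) <= 2 * (1 - g),
      (r %% 4 = 2)%N -> if r == 2%N then 3 * y ^+ 2 <= 2 * (4 - g ^+ 2)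
                        else y ^+ 2 * (4 - g) <= 6 * (2 - g) &
      (r %% 4 = 3)%N -> y ^+ 2 <= 2].
Proof.
move=> /andP[g0 g1] r0 y0 yl.
have le_sq z : lam r g = Num.sqrt z -> 0 <= z -> y ^+ 2 <= z.
  by move=> E z0; apply: sqr_le_of_le_sqrt; rewrite -?E.
have gg : g ^+ 2 <= 1 by rewrite expr_le1// ltW.
split => r4; rewrite /lam r4 /= in le_sq.
- exact: le_sq.
- case: ifP le_sq => _ /(_ _ erefl) H.
    have := H ltac:(apply: divr_ge0; lra); lra.
  rewrite -ler_pdivlMr; last by lra.
  by apply: H; apply: divr_ge0; lra.
- case: ifP le_sq => _ /(_ _ erefl) H.
    have := H ltac:(apply: divr_ge0; lra); lra.
  rewrite -ler_pdivlMr; last by lra.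
  by apply: H; apply: divr_ge0; lra.
- exact: le_sq.
Qed.

Lemma amp_coefE r c k : (k <= r)%N -> amp_coef r c k = k`!%:R^-1.
Proof. by rewrite /amp_coef => ->. Qed.

(** By [dot_amp_even] and [dot_amp_odd] the inner product with [mpow v r.+1] is an alternating sum
    with sign [+] for [r = 0, 3 mod 4] and [-] for [r = 1, 2 mod 4]. In the first case [c = 0]
    suffices; in the second [1 - c < 0] corrects the sign, and the term in [mpow v r.+2] has to be
    compared with it. *)
Lemma amp_stable r g S L v : 0 < g < 1 -> (0 < r)%N -> 0 <= S -> 0 <= L ->
  (forall x, enorm (D *m x) <= L * enorm x) -> S * L <= lam r g ->
  enorm (amp D r (damping r g) S v) <= enorm v.
Proof.
move=> g01 r0 S0 L0 DL SL; have [g0 g1] := andP g01.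
have vS := sqpowS v L0 DL.
apply: (amp_contract Dskew) => // s /andP[s0 sS].
set c := damping r g.
have sL : s * L <= lam r g by rewrite (le_trans _ SL)// ler_wpM2r.
have sL0 : 0 <= s * L by rewrite mulr_ge0.
have [l0 l1 l2 l3] := sqr_lam_le g01 r0 sL0 sL.
set x := (s * L) ^+ 2 in l0 l1 l2 l3.
have x0 : 0 <= x by exact: sqr_ge0.
have rg : 0 < r%:R + g by rewrite ltr_wpDl.
have r1 : r%:R + 1 != 0 :> R by rewrite natr1 pnatr_eq0.
pose ev j i := amp_coef r c i.*2 * s ^+ i.*2 * sqpow D v (i + j).
pose od j i := amp_coef r c i.*2.+1 * s ^+ i.*2.+1 * sqpow D v (i + j).+1.
have rr : (r.+2 <= r.+2.*2)%N by rewrite -addnn leq_addr.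
have HE j := dot_amp_even Dskew c s v j rr.
have HO j := dot_amp_odd Dskew c s v j rr.
rewrite -/(ev _) in HE; rewrite -/(od _) in HO.
have c0 : 0 <= c.
  by rewrite /c /damping; case: ifP => // _; rewrite divr_ge0 ?(ltW rg)// natr1.
have c2 : c <= 2.
  rewrite /c /damping; case: ifP => // _; rewrite ler_pdivrMr//.
  have : 1 <= r%:R :> R by rewrite ler1n.
  lra.
have ev0 j i : 0 <= ev j i.
  by rewrite !mulr_ge0 ?exprn_ge0 ?amp_coef_ge0 ?sqpow_ge0.
have od0 j i : 0 <= od j i.
  by rewrite !mulr_ge0 ?exprn_ge0 ?amp_coef_ge0 ?sqpow_ge0.
have evS K j i : 1 <= K -> c <= K -> K * x <= (i.*2.+1 * i.*2.+2)%:R ->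
    ev j i.+1 <= ev j i.
  move=> K1 cK Kx; have cK' : 0 <= c <= K by rewrite c0.
  exact: (@amp_term_decr r c s L v i.*2 (i + j) K K1 cK' s0 vS Kx).
have odS K j i : 1 <= K -> c <= K -> K * x <= (i.*2.+2 * i.*2.+3)%:R ->
    od j i.+1 <= od j i.
  move=> K1 cK Kx; have cK' : 0 <= c <= K by rewrite c0.
  exact: (@amp_term_decr r c s L v i.*2.+1 (i + j).+1 K K1 cK' s0 vS Kx).
have nle (m k : nat) (y : R) : y <= m%:R -> (m <= k)%N -> y <= k%:R.
  by move=> ym mk; rewrite (le_trans ym)// ler_nat.
have sgn j : (-1) ^+ j.*2 = 1 :> R by rewrite -signr_odd odd_double.
have sgn1 j : (-1) ^+ j.*2.+1 = -1 :> R by rewrite exprS sgn mulr1.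
have := divn_eq r 4; move: (r %/ 4)%N => q rE.
have r4 := ltn_pmod r (isT : (0 < 4)%N).
have sa n : s ^+ 2 * sqpow D v n.+1 <= x * sqpow D v n.
  have -> : x * sqpow D v n = s ^+ 2 * (L ^+ 2 * sqpow D v n).
    by rewrite /x; ring.
  by rewrite ler_wpM2l ?sqr_ge0.
(* Odd powers: consecutive terms decrease as soon as [x <= 2 * 3], the condition at [i = 0]. *)
have [z|nz0] := eqVneq (r %% 4)%N 0%N.
  have cE : c = 0 by rewrite /c /damping z.
  have e1 : r.+1 = q.*2.*2.+1 by rewrite rE z; clear; lia.
  have h := HO q.*2; rewrite -e1 sgn mul1r in h.
  apply: addr_ge0; last by rewrite {1}cE !mul0r.
  apply: mulr_ge0; first by rewrite cE subr0.
  have -> := h.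
  have [] := andP (altsum_bounds r.+2 (od0 q.*2) _) => // i.
  apply: (odS 1) => //; first by rewrite cE.
  rewrite mul1r; apply: (nle 6%N); [exact: l0|clear; nia].
(* Even powers: the condition at [i = 0] is [x <= 1 * 2]. *)
have [z|nz3] := eqVneq (r %% 4)%N 3%N.
  have cE : c = 0 by rewrite /c /damping z.
  have e1 : r.+1 = q.+1.*2.*2 by rewrite rE z; clear; lia.
  have h := HE q.+1.*2; rewrite -e1 sgn mul1r in h.
  apply: addr_ge0; last by rewrite {1}cE !mul0r.
  apply: mulr_ge0; first by rewrite cE subr0.
  have -> := h.
  have [] := andP (altsum_bounds r.+2 (ev0 q.+1.*2) _) => // i.
  apply: (evS 1) => //; first by rewrite cE.
  rewrite mul1r; apply: (nle 2%N); [exact: l3|clear; nia].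
have cE : c = (r%:R + 1) / (r%:R + g).
  by rewrite /c /damping (negbTE nz0) (negbTE nz3).
(* Here [1 - c = - (1 - g) / (r + g)] and [c / (r + 1) = 1 / (r + g)]. *)
have goalE X Z : (1 - c) * X + c / r.+1%:R * s * Z =
    (r%:R + g)^-1 * (s * Z - (1 - g) * X).
  rewrite cE -natr1; field; rewrite r1/= gt_eqF//.
rewrite goalE mulr_ge0 ?invr_ge0 ?(ltW rg)//.
set B := s ^+ 2.
have rgM : (r%:R + g) * c = r%:R + 1 by rewrite cE mulrC divfK// gt_eqF.
have ev_1 j : (2 <= r)%N -> ev j 1%N = 1 / 2 * (B * sqpow D v j.+1).
  by move=> r2; rewrite /ev -[1.*2]/2%N amp_coefE// add1n -[2`!]/2%N /B; field.
have od_1 j : (3 <= r)%N -> od j 1%N = s * (1 / 6 * (B * sqpow D v j.+2)).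
  by move=> r3; rewrite /od -[1.*2.+1]/3%N amp_coefE// add1n -[3`!]/6%N /B; field.
have [z|nz1] := eqVneq (r %% 4)%N 1%N.
  have e1 : r.+1 = q.*2.+1.*2 by rewrite rE z; clear; lia.
  have h1 := HE q.*2.+1; rewrite -e1 sgn1 in h1.
  have h2 := HO q.*2.+1; rewrite -e1 sgn1 in h2.
  rewrite h1 h2 !mulN1r !mulrN opprK addrC subr_ge0.
  rewrite -/(ev _) -/(od _).
  have hx := l1 z; set A0 := sqpow D v q.*2.+1; set A1 := sqpow D v q.*2.+2.
  have A00 : 0 <= A0 by exact: sqpow_ge0.
  have A10 : 0 <= A1 by exact: sqpow_ge0.
  have hsa : B * A1 <= x * A0 by exact: sa.
  have ev_0 : ev q.*2.+1 0%N = A0.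
    by rewrite /ev amp_coefE// fact0 invr1 expr0 !mul1r.
  have od_0 : od q.*2.+1 0%N = s * A1.
    by rewrite /od amp_coefE// (_ : (0.*2.+1)`! = 1%N)// invr1 expr1 mul1r.
  (* For [r = 1] the term in [D^2] already carries the modified coefficient [c / 2], and the sums
     are computed exactly. *)
  case: (eqVneq r 1%N) hx => [r1' hx|r1' hx].
    have -> : altsum r.+2 (ev q.*2.+1) = A0 - c / 2 * (B * A1).
      rewrite /altsum r1' !big_ord_recr big_ord0 /= ev_0.
      rewrite /ev /amp_coef r1' /= mul0r !mul0r expr0 /A1 /B; ring.
    have -> : altsum r.+2 (od q.*2.+1) = s * A1.
      rewrite /altsum r1' !big_ord_recr big_ord0 /= od_0.
      rewrite /od /amp_coef r1' /= !mul0r expr0; ring.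
    rewrite r1' in rgM.
    have -> : s * (s * A1) = B * A1 by rewrite /B; ring.
    rewrite -(ler_pM2l rg) r1'.
    have -> : (1%:R + g) * ((1 - g) * (A0 - c / 2 * (B * A1))) =
      (1 - g ^+ 2) * A0 - (1 - g) / 2 * ((1%:R + g) * c) * (B * A1) by field.
    rewrite rgM.
    have := ler_wpM2r A00 hx; lra.
  have r5 : (5 <= r)%N by clear -rE z r1'; lia.
  have c2' : 1 <= (2 : R) by lra.
  have xle : x <= 1.
    by have : x * (3 - g) <= 1 * (3 - g); [lra|rewrite ler_pM2r//; lra].
  have hAE : A0 - 1 / 2 * (B * A1) <= altsum r.+2 (ev q.*2.+1).
    have <- : ev q.*2.+1 0%N - ev q.*2.+1 1%N = A0 - 1 / 2 * (B * A1).
      by rewrite ev_0 ev_1//; exact: leq_trans r5.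
    apply: altsum_ge => // i i2; apply: (evS 2) => //.
    by apply: (nle 2%N); [lra|clear -i2; nia].
  have hAO : altsum r.+2 (od q.*2.+1) <= s * A1.
    rewrite -od_0; have [] := andP (altsum_bounds r.+2 (od0 q.*2.+1) _) => // i.
    by apply: (odS 2) => //; apply: (nle 2%N); [lra|clear; nia].
  (* It remains that [(1 - g) A0 - (3 - g) / 2 * B * A1] is nonnegative; with [B * A1 <= x * A0]
     this is the CFL bound. *)
  have := ler_wpM2l s0 hAO; have -> : s * (s * A1) = B * A1 by rewrite /B; ring.
  have g1' : 0 <= 1 - g by lra.
  have := ler_wpM2l g1' hAE.
  have := ler_wpM2r A00 hx.
  have g3 : 0 <= 3 - g by lra.
  have := ler_wpM2r g3 hsa; lra.
have z : (r %% 4)%N = 2%N by clear -r4 nz0 nz1 nz3; lia.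
have e1 : r.+1 = q.*2.+1.*2.+1 by rewrite rE z; clear; lia.
have e2 : r.+2 = q.+1.*2.*2 by rewrite rE z; clear; lia.
have h1 := HO q.*2.+1; rewrite -e1 sgn1 in h1.
have h2 := HE q.+1.*2; rewrite -e2 sgn in h2.
rewrite h1 h2 mulN1r mul1r mulrN opprK.
rewrite -/(ev _) -/(od _).
have hx := l2 z; set A0 := sqpow D v q.+1.*2; set A1 := sqpow D v q.+1.*2.+1.
have A00 : 0 <= A0 by exact: sqpow_ge0.
have A10 : 0 <= A1 by exact: sqpow_ge0.
have hsa : B * A1 <= x * A0 by exact: sa.
have ev_0 : ev q.+1.*2 0%N = A0.
  by rewrite /ev amp_coefE// fact0 invr1 expr0 !mul1r.
have od_0 : od q.*2.+1 0%N = s * A0.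
  by rewrite /od amp_coefE// (_ : (0.*2.+1)`! = 1%N)// invr1 expr1 mul1r.
have g1' : 0 <= 1 - g by lra.
have r2 : (2 <= r)%N by clear -rE z; lia.
(* For [r = 2] the term in [D^3] carries the modified coefficient [c / 6]. *)
case: (eqVneq r 2%N) hx => [r1' hx|r1' hx].
  have -> : altsum r.+2 (ev q.+1.*2) = A0 - 1 / 2 * (B * A1).
    rewrite /altsum r1' !big_ord_recr big_ord0 /= ev_0 ev_1//.
    rewrite /ev /amp_coef r1' /= !mul0r expr0 -/A1; ring.
  have -> : altsum r.+2 (od q.*2.+1) = s * A0 - c / 6 * s * (B * A1).
    rewrite /altsum r1' !big_ord_recr big_ord0 /= od_0.
    rewrite /od /amp_coef r1' /= !mul0r expr0 -[sqpow D v q.*2.+3]/A1.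
    by rewrite (_ : 3`! = 6)%N// /B; ring.
  rewrite r1' in rgM; rewrite r1' in rg.
  have -> : s * (A0 - 1 / 2 * (B * A1)) +
      (1 - g) * (s * A0 - c / 6 * s * (B * A1)) =
    s * ((2 - g) * A0 - (1 / 2 + (1 - g) * c / 6) * (B * A1)) by field.
  rewrite mulr_ge0// -(pmulr_rge0 _ rg).
  have -> : (2%:R + g) * ((2 - g) * A0 - (1 / 2 + (1 - g) * c / 6) * (B * A1)) =
    (4 - g ^+ 2) * A0 - (1 + g / 2 + (1 - g) / 6 * ((2%:R + g) * c)) * (B * A1).
    by field.
  rewrite rgM.
  have := ler_wpM2r A00 hx; lra.
have r6 : (6 <= r)%N by clear -rE z r1'; lia.
have c2' : 1 <= (2 : R) by lra.
have xle : x <= 3.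
  by have : x * (4 - g) <= 3 * (4 - g); [lra|rewrite ler_pM2r//; lra].
have r3 : (3 <= r)%N by exact: leq_trans r6.
have hAE : A0 - 1 / 2 * (B * A1) <= altsum r.+2 (ev q.+1.*2).
  rewrite -ev_1// -{1}ev_0; apply: altsum_ge => // i i2; apply: (evS 2) => //.
  by apply: (nle 6%N); [lra|clear -i2; nia].
have hAO : s * A0 - s * (1 / 6 * (B * A1)) <= altsum r.+2 (od q.*2.+1).
  rewrite -od_1// -{1}od_0; apply: altsum_ge => // i i2; apply: (odS 2) => //.
  by apply: (nle 6%N); [lra|clear -i2; nia].
(* Both sums start with a multiple of [A0] and add up, which is why this bound is weaker than the
   one for [r = 1 mod 4]. *)
apply: le_trans (lerD (ler_wpM2l s0 hAE) (ler_wpM2l g1' hAO)).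
have -> : s * (A0 - 1 / 2 * (B * A1)) +
    (1 - g) * (s * A0 - s * (1 / 6 * (B * A1))) =
  s * ((2 - g) * A0 - (4 - g) / 6 * (B * A1)) by field.
apply: mulr_ge0 => //.
have := ler_wpM2r A00 hx.
have g4 : 0 <= 4 - g by lra.
have := ler_wpM2r g4 hsa; lra.
Qed.

End Stability.

(** * Polynomials in Taylor form *)

Section ExponentialPolynomials.
Context {R : realType}.
Implicit Types (a t x : R) (p q : {poly R}) (c : nat -> R).

(** The factorials make differentiation a shift of [c], which is what Picard iteration needs. *)
Definition expoly a n c : {poly R} :=
  \sum_(k < n) (c k / k`!%:R) *: ('X - a%:P) ^+ k.

Lemma deriv_expoly a n c : (expoly a n.+1 c)^`() = expoly a n (fun k => c k.+1).
Proof.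
rewrite /expoly big_ord_recl derivD /= derivZ derivC scaler0 add0r raddf_sum.
apply: eq_bigr => k _; rewrite /bump leq0n add1n /= derivZ deriv_exp derivB derivX derivC.
rewrite subr0 mul1r /= -scalerMnr scalerMnl factS natrM; congr (_ *: _).
have k0 : k.+1%:R != 0 :> R by rewrite pnatr_eq0.
by rewrite -[LHS]mulr_natr invfM mulrA mulrAC divfK.
Qed.

Lemma horner_expoly a n c x :
  (expoly a n c).[x] = \sum_(k < n) c k / k`!%:R * (x - a) ^+ k.
Proof.
rewrite /expoly horner_sum; apply: eq_bigr => k _.
by rewrite hornerZ horner_exp hornerXsubC.
Qed.

Lemma expoly_base a n c : (expoly a n.+1 c).[a] = c 0%N.
Proof.
rewrite horner_expoly big_ord_recl big1 => [|k _].
  by rewrite fact0 divr1 mulr1 addr0.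
by rewrite lift0 subrr expr0n/= mulr0.
Qed.

Lemma poly_eq_deriv a p q : p^`() = q^`() -> p.[a] = q.[a] -> p = q.
Proof.
move=> pq pa; apply/eqP; rewrite -subr_eq0; set d := p - q.
have dE : d = (d`_0)%:P.
  apply/size1_polyC/leq_sizeP => -[//|i] _; have : d^`() = 0.
    by rewrite derivB pq subrr.
  move=> /polyP/(_ i)/eqP; rewrite coef_deriv coef0 mulrn_eq0 /= => /eqP.
  by [].
have : d.[a] = 0 by rewrite hornerD hornerN pa subrr.
by rewrite dE hornerC => ->; rewrite polyC0.
Qed.

Lemma sum_exp_coeff_le n x : 0 <= x ->
  \sum_(k < n) x ^+ k / k`!%:R <= expR x.
Proof.
move=> x0; have -> : \sum_(k < n) x ^+ k / k`!%:R = series (exp_coeff x) n.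
  by rewrite /series /= big_mkord.
apply: nondecreasing_cvgn_le; last exact: is_cvg_series_exp_coeff.
apply/nondecreasing_seqP => k; rewrite /series /= big_nat_recr//= lerDl.
exact: exp_coeff_ge0.
Qed.

Lemma exprn_fact_le n x : 0 <= x -> x ^+ n / n`!%:R <= expR x.
Proof.
move=> x0; apply: le_trans (sum_exp_coeff_le n.+1 x0).
by rewrite big_ord_recr/= lerDr sumr_ge0// => k _; rewrite divr_ge0// exprn_ge0.
Qed.

End ExponentialPolynomials.

(** * Error of the Picard iteration *)

Section PicardIteration.
Context {R : realType} {M : nat} (D : 'M[R]_M).
Implicit Types (a b t : R) (v : 'cV[R]_M).

(** A crude size of [D] for the componentwise Picard estimate. It affects only the constant;
    stability uses the sharp [opnorm]. *)
Definition mxsum : R := \sum_i \sum_j `|D i j|.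

Lemma mxsum_ge0 : 0 <= mxsum.
Proof. by apply: sumr_ge0 => i _; apply: sumr_ge0. Qed.

Lemma mulmx_le v K i : 0 <= K -> (forall j, `|v j 0| <= K) ->
  `|(D *m v) i 0| <= mxsum * K.
Proof.
move=> K0 vK; rewrite mxE (le_trans (ler_norm_sum _ _ _))//.
rewrite [mxsum](bigD1 i)//= mulrDl -[leLHS]addr0 lerD//; last first.
  by rewrite mulr_ge0// sumr_ge0// => k _; exact: sumr_ge0.
rewrite mulr_suml; apply: ler_sum => j _; rewrite normrM ler_wpM2l//.
Qed.

Lemma mpow_le v K n i : 0 <= K -> (forall j, `|v j 0| <= K) ->
  `|mpow D v n i 0| <= mxsum ^+ n * K.
Proof.
move=> K0 vK; elim: n i => [|n IH] i; first by rewrite expr0 mul1r vK.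
rewrite exprS -mulrA; apply: mulmx_le => //.
by rewrite mulr_ge0// exprn_ge0// mxsum_ge0.
Qed.

Lemma horner_vpmul (P : vpoly R M) i t :
  (vpmul D P i).[t] = (D *m vpeval P t) i 0.
Proof.
rewrite /vpmul horner_sum mxE; apply: eq_bigr => k _.
by rewrite hornerM hornerC mxE.
Qed.

(** The differential equation is known only on an open interval; the endpoints have measure zero. *)
Lemma AC_eq_oo a b (f g g' : R -> R) : AC a b f g -> L2 a b g' ->
  (forall x, a < x < b -> g x = g' x) -> AC a b f g'.
Proof.
move=> [lg fE] lg' gg'; split => // t abt; rewrite fE//; congr (_ + _).
case/andP: abt => at_ tb.
have l1 : L1 a t g by apply: L1_sub (L2_L1 lg).
have l2 : L1 a t g' by apply: L1_sub (L2_L1 lg').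
have oo h : L1 a t h -> integ a t h =
    Rintegral (@lebesgue_measure R) `]a, t[%classic h.
  move=> lh; rewrite /integ /Icc -Rintegral_itv_bndo_bndc; last first.
    apply: integrableS lh => //; first exact: measurable_Icc.
    move=> x; rewrite /= in_itv/= => /andP[ax /ltW xt].
    by apply/mem_Icc; rewrite ax xt.
  rewrite Rintegral_itv_obnd_cbnd//; apply: integrableS lh => //.
    exact: measurable_Icc.
  move=> x; rewrite /= in_itv/= => /andP[/ltW ax /ltW xt].
  by apply/mem_Icc; rewrite ax xt.
rewrite !oo//; apply: eq_Rintegral => x; rewrite inE/= in_itv/= => /andP[ax xt].
by apply: gg'; rewrite ax (lt_le_trans xt).
Qed.

(* The bound solves the scalar recursion [z_0 = A], [z_(m+1)' = mxsum * z_m],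
   [z_(m+1)(a) = B]. *)
Lemma picard_error a b (Y f : R -> 'cV[R]_M) (IR : vpoly R M)
    (P : nat -> vpoly R M) r A B : a <= b -> 0 <= A -> 0 <= B ->
  (forall i, L2 a b (fun t => f t i 0)) ->
  (forall i, AC a b (fun t => Y t i 0) (fun t => (D *m Y t + f t) i 0)) ->
  (forall i, P 0%N i = (Y a i 0)%:P) ->
  (forall m i, (m < r)%N -> (P m.+1 i)^`() = vpmul D (P m) i + IR i) ->
  (forall m i, (m < r)%N -> (P m.+1 i).[a] = Y a i 0) ->
  (forall t i, a <= t <= b -> `|Y t i 0 - Y a i 0| <= A) ->
  (forall t i, a <= t <= b -> `|integ a t (fun s => f s i 0 - (IR i).[s])| <= B) ->
  forall m t i, (m <= r)%N -> a <= t <= b ->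
   `|Y t i 0 - (P m i).[t]| <= (expoly a m.+1
       (fun k => (if k == m then A else B) * mxsum ^+ k)).[t].
Proof.
move=> ab A0 B0 lf HY P0 PD Pa YA fB.
elim=> [|m IH] t i mr abt.
  by rewrite P0 hornerC horner_expoly big_ord1/= fact0 divr1 !expr0 !mulr1 YA.
set bp := expoly a m.+1 _ in IH.
set bp' := expoly a m.+2 _.
have bpD : bp'^`() = mxsum *: bp.
  rewrite /bp' deriv_expoly /bp /expoly scaler_sumr; apply: eq_bigr => k _.
  by rewrite scalerA eqSS exprS; congr (_ *: _); ring.
have bpa : bp'.[a] = B by rewrite expoly_base mulr1.
case/andP: (abt) => at_ tb.
have lY j : L2 a b (fun t => Y t j 0) := AC_L2 ab (HY j).
pose e s : 'cV[R]_M := Y s - vpeval (P m) s.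
have le j : L2 a t (fun s => e s j 0).
  apply: (@L2_eq _ _ _ (fun s => Y s j 0 - (P m j).[s])).
    by move=> s _; rewrite !mxE.
  by apply: L2B; [exact: L2_sub (lY j)|exact: L2_horner].
have lDe : L1 a t (fun s => (D *m e s) i 0).
  apply: (@L1_eq _ _ _ (fun s => \sum_j D i j * e s j 0)).
    by move=> s _; rewrite mxE.
  by apply: L1_sum => j; apply/L1Z/L2_L1/le.
have lfI : L1 a t (fun s => f s i 0 - (IR i).[s]).
  by apply: L1B; [apply: L1_sub (L2_L1 (lf i))|exact/L2_L1/L2_horner].
have -> : Y t i 0 - (P m.+1 i).[t] = integ a t (fun s => (D *m e s) i 0) +
    integ a t (fun s => f s i 0 - (IR i).[s]).
  have [_ /(_ t abt)] := ACB (HY i) (AC_horner a b (P m.+1 i)).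
  rewrite Pa// subrr add0r => ->; rewrite -integD//; apply: integ_eq => s _.
  rewrite PD// hornerD horner_vpmul /e mulmxBr !mxE; ring.
rewrite (le_trans (ler_normD _ _))//.
have -> : bp'.[t] = integ a t (horner (mxsum *: bp)) + B.
  by rewrite -bpD -bpa; have [_ ->//] := AC_horner a b bp'; rewrite addrC.
rewrite lerD ?fB// (le_trans (integ_norm lDe))//; apply: integ_le.
- exact: L1_norm.
- exact/L2_L1/L2_horner.
- move=> s /andP[as_ st]; rewrite hornerZ; apply: mulmx_le.
    rewrite (le_trans (normr_ge0 _) (IH s i (ltnW mr) _))//.
    by rewrite as_ (le_trans st).
  move=> j; rewrite !mxE; apply: IH; first exact: ltnW.
  by rewrite as_ (le_trans st).
Qed.

End PicardIteration.

(** * The scheme as a Picard iteration with a correction term *)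

Section SchemeStructure.
Context {R : realType} {M : nat} (D : 'M[R]_M).
Implicit Types (a b t g : R) (u v : 'cV[R]_M).

Lemma mpowB u v n : mpow D (u - v) n = mpow D u n - mpow D v n.
Proof. by elim: n => [//|n IH]; rewrite !mpowS IH mulmxBr. Qed.

Lemma expoly_mulmx a n (u : nat -> 'cV[R]_M) i :
  expoly a n (fun k => (D *m u k) i 0) =
  vpmul D (fun j => expoly a n (fun k => u k j 0)) i.
Proof.
rewrite /vpmul /expoly; under [RHS]eq_bigr => j _ do rewrite mulr_sumr.
rewrite exchange_big/=; apply: eq_bigr => k _.
rewrite mxE mulr_suml scaler_suml; apply: eq_bigr => j _.
by rewrite mul_polyC scalerA mulrA.
Qed.

Lemma vpmulD (P Q : vpoly R M) i :
  vpmul D (fun j => P j + Q j) i = vpmul D P i + vpmul D Q i.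
Proof.
by rewrite /vpmul -big_split; apply: eq_bigr => j _; rewrite mulrDr.
Qed.

Lemma vpmulZ k (P : vpoly R M) i :
  vpmul D (fun j => k *: P j) i = k *: vpmul D P i.
Proof.
by rewrite /vpmul scaler_sumr; apply: eq_bigr => j _; rewrite scalerAr.
Qed.

Lemma damping_ge0 r g : 0 < g -> 0 <= damping r g :> R.
Proof.
by move=> g0; rewrite /damping; case: ifP => // _; rewrite divr_ge0// addr_ge0// ltW.
Qed.

Lemma damping_le r g : 0 < g -> (0 < r)%N -> damping r g <= r.+1%:R :> R.
Proof.
move=> g0 r0; rewrite /damping; case: ifP => // _; rewrite natr1.
have r1 : 1 <= r%:R :> R by rewrite ler1n.
have rg : 1 <= r%:R + g by lra.
by rewrite ler_pdivrMr ?(lt_le_trans ltr01)// ler_peMr.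
Qed.

(* The product of the [gam r g m] telescopes to [(r + 1) g / (r + g)]. *)
Lemma tilde_sub_repr r g a Yn (Y Yt : nat -> vpoly R M) (IR : vpoly R M) :
  0 < g -> (0 < r)%N ->
  vpderiv (Yt 0%N) = vpscale g^-1 (vpmul D (vpconst Yn)) ->
  vpeval (Yt 0%N) a = Yn -> Y 0%N = vpconst Yn ->
  (forall m, (1 <= m <= r)%N ->
     [/\ vpderiv (Y m) = vpadd (vpmul D (Y m.-1)) IR, vpeval (Y m) a = Yn,
        vpderiv (Yt m) = vpadd (vpmul D (vpadd (vpscale (gam r g m) (Yt m.-1))
                               (vpscale (1 - gam r g m) (Y m.-1)))) IR &
        vpeval (Yt m) a = Yn]) ->
  forall i, Yt r i = Y r i +
    (damping r g / r.+1`!%:R * mpow D Yn r.+1 i 0) *: ('X - a%:P) ^+ r.+1.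
Proof.
move=> g0 r0 dYt0 Yt0a Y0 HY.
have evE (P : vpoly R M) v i : vpeval P a = v -> (P i).[a] = v i 0.
  by move=> <-; rewrite mxE.
have dXa n : (('X - a%:P : {poly R}) ^+ n.+1)^`() = ('X - a%:P) ^+ n *+ n.+1.
  by rewrite deriv_exp derivB derivX derivC subr0 mul1r.
have Xa n : (('X - a%:P : {poly R}) ^+ n.+1).[a] = 0.
  by rewrite horner_exp hornerXsubC subrr expr0n.
(* [Yt m - Y m] is the single term [cf m * mpow D Yn m.+1] times [(X - a)^(m+1)]. If [gam] is
   nonzero, the formula for [m > 0] also gives [g^-1] at [m = 0]; if it is zero, the difference
   disappears from [m = 1] on. *)
pose cf m : R := if m is m'.+1 then
  (if (r %% 4 == 0)%N || (r %% 4 == 3)%N then 0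
   else (m%:R + 1) / (m%:R + g)) / m.+1`!%:R else g^-1.
have cfS m : gam r g m.+1 * cf m = cf m.+1 * m.+2%:R.
  rewrite /gam /cf; case: ifP => _; first by rewrite !mul0r.
  have gn : g != 0 by rewrite gt_eqF.
  case: m => [|m].
    have g1 : 1 + g != 0 by rewrite gt_eqF// addr_gt0.
    by rewrite (_ : 2`! = 2)%N//; field; rewrite ?g1 ?gn.
  have f0 : m.+2`!%:R != 0 :> R by rewrite pnatr_eq0 -lt0n fact_gt0.
  have m1 : m.+2%:R != 0 :> R by rewrite pnatr_eq0.
  have m2 : m.+3%:R != 0 :> R by rewrite pnatr_eq0.
  have mg : m.+2%:R + g != 0 by rewrite gt_eqF// addr_gt0.
  have mg' : m.+1%:R + g != 0 by rewrite gt_eqF// addr_gt0.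
  rewrite [m.+3`!]factS natrM; move: (m.+2`!%:R : R) f0 => F f0.
  rewrite -!natr1 in m1 m2 mg mg' *.
  by field; rewrite ?f0 ?m1 ?m2 ?mg ?mg'.
have E m i : (m <= r)%N -> Yt m i = Y m i +
    (cf m * mpow D Yn m.+1 i 0) *: ('X - a%:P) ^+ m.+1.
  elim: m i => [|m IH] i mr.
    apply: (@poly_eq_deriv _ a).
      have := congr1 (fun F => F i) dYt0; rewrite /vpderiv /vpscale => ->.
      rewrite Y0 derivD derivC add0r derivZ dXa expr0 mulr1n.
      have -> : vpmul D (vpconst Yn) i = ((D *m Yn) i 0)%:P.
        rewrite /vpmul mxE rmorph_sum; apply: eq_bigr => j _.
        by rewrite /= polyCM.
      by rewrite alg_polyC -mul_polyC -polyCM.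
    by rewrite (evE _ _ _ Yt0a) Y0 hornerD hornerZ Xa mulr0 addr0 hornerC.
  have [dY Ya dYt Yta] := HY m.+1 mr.
  apply: (@poly_eq_deriv _ a); last first.
    by rewrite hornerD hornerZ Xa mulr0 addr0 (evE _ _ _ Ya) (evE _ _ _ Yta).
  have := congr1 (fun F => F i) dYt; rewrite {1}/vpderiv => ->.
  rewrite derivD derivZ dXa.
  have := congr1 (fun F => F i) dY; rewrite {1}/vpderiv => ->.
  rewrite /vpadd /= -addrA [IR i + _]addrC addrA; congr (_ + _).
  have -> : vpmul D (fun j => vpscale (gam r g m.+1) (Yt m) j +
       vpscale (1 - gam r g m.+1) (Y m) j) i =
     vpmul D (fun j => Y m j + gam r g m.+1 *: (Yt m j - Y m j)) i.
    apply: eq_bigr => j _; congr (_ * _); rewrite /vpscale.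
    by rewrite scalerBl scale1r scalerBr; ring.
  rewrite vpmulD; congr (_ + _); rewrite vpmulZ.
  have -> : vpmul D (fun j => Yt m j - Y m j) i =
      (cf m * mpow D Yn m.+2 i 0) *: ('X - a%:P) ^+ m.+1.
    rewrite /vpmul [mpow D Yn m.+2 i 0]mxE mulr_sumr scaler_suml.
    apply: eq_bigr => j _; rewrite IH ?(ltnW mr)// addrAC subrr add0r.
    by rewrite mul_polyC scalerA; congr (_ *: _); rewrite -/(mpow D Yn m.+1); ring.
  rewrite scalerA -scalerMnr scalerMnl; congr (_ *: _).
  transitivity (cf m.+1 * m.+2%:R * mpow D Yn m.+2 i 0).
    by rewrite mulrA cfS.
  by rewrite -[RHS]mulr_natr [RHS]mulrAC.
move=> i; rewrite E//; congr (_ + (_ * _) *: _).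
by rewrite /cf /damping; case: (_ || _); case: (r) r0.
Qed.

(** The step is affine in its initial value. Adding to [Y m] the Taylor polynomial of order [m] of
    [exp ((t - a) D) (Ya - Yn)] gives the Picard iterates started at [Ya]; the correction at [Yn]
    splits into one at [Ya] and the top term of [amp]. *)
Lemma scheme_repr r g (f : R -> 'cV[R]_M) a b Yn (Ytr : vpoly R M) (Ya : 'cV[R]_M) :
  0 < g -> (0 < r)%N -> scheme_step D r g f a b Yn Ytr ->
  exists (IR : vpoly R M) (P : nat -> vpoly R M),
  [/\ is_L2proj r a b f IR, forall i, P 0%N i = (Ya i 0)%:P,
      forall m i, (m < r)%N -> (P m.+1 i)^`() = vpmul D (P m) i + IR i,
      forall m i, (m < r)%N -> (P m.+1 i).[a] = Ya i 0 &
      forall t, vpeval Ytr t = vpeval (P r) t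
        - amp D r (damping r g) (t - a) (Ya - Yn)
        + (damping r g / r.+1`!%:R * (t - a) ^+ r.+1) *: mpow D Ya r.+1].
Proof.
move=> g0 r0 [IR [Y [Yt [HIR [Y0 [_ [dYt0 [Yt0a [HY ->]]]]]]]]].
have {}HY m : (1 <= m <= r)%N ->
     [/\ vpderiv (Y m) = vpadd (vpmul D (Y m.-1)) IR, vpeval (Y m) a = Yn,
        vpderiv (Yt m) = vpadd (vpmul D (vpadd (vpscale (gam r g m) (Yt m.-1))
                               (vpscale (1 - gam r g m) (Y m.-1)))) IR &
        vpeval (Yt m) a = Yn].
  by move=> /HY[_ [h1 [h2 [_ [h3 h4]]]]].
have YtE := tilde_sub_repr g0 r0 dYt0 Yt0a Y0 HY.
set e := Ya - Yn.
exists IR, (fun m i => Y m i + expoly a m.+1 (fun k => mpow D e k i 0)).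
split => //.
- move=> i; rewrite Y0 /expoly big_ord1 /= fact0 divr1 expr0 alg_polyC.
  by rewrite /vpconst -polyCD /e !mxE [Yn i 0 + _]addrC subrK.
- move=> m i mr; have [dY _ _ _] := HY m.+1 mr.
  rewrite derivD deriv_expoly.
  have := congr1 (fun F => F i) dY; rewrite {1}/vpderiv => ->.
  by rewrite vpmulD -expoly_mulmx /vpadd /= addrAC.
- move=> m i mr; have [_ Ym _ _] := HY m.+1 mr.
  rewrite hornerD expoly_base.
  have := congr1 (fun v : 'cV[R]_M => v i 0) Ym; rewrite mxE => ->.
  by rewrite -[mpow D e 0]/e /e !mxE; ring.
- move=> t; apply/colP => i; rewrite !mxE YtE.
  have -> : amp D r (damping r g) (t - a) e i 0 =
      (expoly a r.+1 (fun k => mpow D e k i 0)).[t] +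
      damping r g / r.+1`!%:R * (t - a) ^+ r.+1 * mpow D e r.+1 i 0.
    rewrite /amp big_ord_recr/= !mxE summxE horner_expoly; congr (_ + _ * _ * _).
      apply: eq_bigr => k _; rewrite mxE amp_coefE; first by ring.
      by rewrite -ltnS.
    by rewrite /amp_coef ltnn eqxx.
  rewrite /e mpowB !hornerE /= !mxE; ring.
Qed.

End SchemeStructure.

(** * Error over one step *)

Section LocalError.
Context {R : realType} {M : nat} (D : 'M[R]_M).
Implicit Types (a b t g : R) (u v : 'cV[R]_M).

Lemma le_sqrt_of_sqr (x y : R) : x ^+ 2 <= y -> `|x| <= Num.sqrt y.
Proof. by move=> xy; rewrite -sqrtr_sqr; exact: ler_wsqrtr. Qed.

Definition proj_const a b r s : R := \prod_(i < s) ((b - a) / (r - i)%:R).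

(** Besides the propagated initial error there are the Picard error (the summand [1] and the
    projection term) and the correction term at the exact value [Y a] (the summands
    [mxsum D + x]). *)
Lemma local_error a b r s g (Y f dY : R -> 'cV[R]_M) (G : nat -> R -> 'cV[R]_M)
    Yn (Ytr : vpoly R M) W : a < b -> 0 < g -> (0 < r)%N -> (0 < s <= r)%N ->
  scheme_step D r g f a b Yn Ytr ->
  (forall i, AC a b (fun t => Y t i 0) (fun t => dY t i 0)) ->
  (forall i t, a < t < b -> dY t i 0 = (D *m Y t + f t) i 0) ->
  (forall t, a <= t <= b -> G 0%N t = f t) ->
  (forall i j, (j < s)%N -> AC a b (fun t => G j t i 0) (fun t => G j.+1 t i 0)) ->
  (forall i, integ a b (fun t => Y t i 0 ^+ 2) <= W) ->
  (forall i, integ a b (fun t => dY t i 0 ^+ 2) <= W) ->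
  (forall i, integ a b (fun t => G s t i 0 ^+ 2) <= W) ->
  let x := mxsum D * (b - a) in
  forall t, a <= t <= b ->
  enorm (Y t - vpeval Ytr t) <=
    enorm (amp D r (damping r g) (t - a) (Y a - Yn)) +
    M%:R * (Num.sqrt ((b - a) * W) *
      (x ^+ r / r`!%:R * (1 + mxsum D + x) + expR x * proj_const a b r s)).
Proof.
move=> ab g0 r0 /andP[s0 sr] Hstep HY dYE G0 HG WY WdY WG x t abt.
have [IR [P [[HIR1 HIR2] P0 PD Pa PE]]] := scheme_repr (Y a) g0 r0 Hstep.
have ab' := ltW ab.
set h := b - a in x *; have h0 : 0 < h by rewrite subr_gt0.
set d := mxsum D in x *; have d0 : 0 <= d := mxsum_ge0 D.
have x0 : 0 <= x by rewrite mulr_ge0// ltW.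
pose S := Num.sqrt (h * W); have S0 : 0 <= S by exact: sqrtr_ge0.
set Pi := proj_const a b r s.
have Pi0 : 0 <= Pi by apply: prodr_ge0 => i _; rewrite divr_ge0// ltW.
have lY i : L2 a b (fun t => Y t i 0) := AC_L2 ab' (HY i).
have lf i : L2 a b (fun t => f t i 0).
  apply: (@L2_eq _ _ _ (fun t => G 0%N t i 0)) => [u abu|]; first by rewrite G0.
  exact: AC_L2 ab' (HG i 0%N s0).
have HY' i : AC a b (fun t => Y t i 0) (fun t => (D *m Y t + f t) i 0).
  apply: AC_eq_oo (HY i) _ (dYE i).
  apply: (@L2_eq _ _ _ (fun t => \sum_j D i j * Y t j 0 + f t i 0)).
    by move=> u _; rewrite !mxE.
  apply: L2D => //; elim: (index_enum _) => [|j js IH].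
    apply: (@L2_eq _ _ _ (horner 0)); last exact: L2_horner.
    by move=> u _; rewrite big_nil horner0.
  apply: (@L2_eq _ _ _ (fun t => D i j * Y t j 0 +
     \sum_(j <- js) D i j * Y t j 0)); first by move=> u _; rewrite big_cons.
  by apply: L2D => //; exact: L2Z.
have le_hW (u X : R) : a <= u <= b -> X <= W -> (u - a) * X <= h * W \/ X < 0.
  move=> /andP[au ub] XW; have [X0|] := leP 0 X; last by right.
  by left; rewrite ler_pM ?subr_ge0// lerD2r.
have YA (u : R) i : a <= u <= b -> `|Y u i 0 - Y a i 0| <= S.
  move=> abu; apply: le_sqrt_of_sqr; case/andP: (abu) => au ub.
  apply: (le_trans (AC_sq_le (HY i) (lexx a) au ub)).
  have [//|] := le_hW _ _ abu (WdY i).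
  by rewrite ltNge integ_ge0// => y _; exact: sqr_ge0.
have lfI i : L2 a b (fun t => f t i 0 - (IR i).[t]).
  by apply: L2B (lf i) (L2_horner _ _ _).
have fB (u : R) i : a <= u <= b ->
    `|integ a u (fun s => f s i 0 - (IR i).[s])| <= Pi * S.
  move=> abu; case/andP: (abu) => au ub.
  have -> : Pi * S = Num.sqrt (Pi ^+ 2 * (h * W)).
    by rewrite sqrtrM ?sqr_ge0// sqrtr_sqr ger0_norm.
  apply: le_sqrt_of_sqr.
  have lu : L2 a u (fun t => f t i 0 - (IR i).[t]) by exact: L2_sub (lfI i).
  apply: (le_trans (integ_sq au lu)).
  have err : integ a b (fun t => (f t i 0 - (IR i).[t]) ^+ 2) <= Pi ^+ 2 * W.
    apply: (@le_trans _ _ (Pi ^+ 2 * integ a b (fun t => G s t i 0 ^+ 2))).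
      have e1 : integ a b (fun t => (f t i 0 - (IR i).[t]) ^+ 2) =
          integ a b (fun t => (G 0%N t i 0 - (IR i).[t]) ^+ 2).
        by apply: integ_eq => y aby; rewrite G0.
      rewrite e1; apply: (@proj_error _ a b (fun j t => G j t i 0) (IR i) r s) => //.
      - exact: AC_L2 ab' (HG i 0%N s0).
      - by move=> j js; exact: HG.
      - by have := HIR1 i; rewrite prednK.
      - move=> q qr; rewrite -[RHS](HIR2 i q qr); apply: integ_eq => y aby.
        by rewrite G0.
    by rewrite ler_wpM2l ?sqr_ge0.
  have -> : Pi ^+ 2 * (h * W) = h * (Pi ^+ 2 * W) by ring.
  apply: ler_pM => //; rewrite ?subr_ge0 ?lerD2r//.
    by apply: integ_ge0 => y _; exact: sqr_ge0.
  apply: le_trans err; apply: integ_sub_le => //; first exact: (lfI i).2.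
  by move=> y _; exact: sqr_ge0.
(* A point value is bounded by comparison with the mean of [Y]. The factor [1 / h] is paid for by
   the extra power of [h] in the correction term. *)
have YaK i : `|Y a i 0| <= (1 + h) / h * S.
  rewrite mulrAC ler_pdivlMr//.
  have -> : `|Y a i 0| * h = `|integ a b (fun t => Y t i 0) -
      integ a b (fun t => Y t i 0 - Y a i 0)|.
    rewrite -integB; [|exact: L2_L1|by apply: L1B; [exact: L2_L1|exact: L1_cst]].
    rewrite (@integ_eq _ _ _ _ (fun=> Y a i 0)) => [|y _]; last by ring.
    by rewrite integ_cst// normrM (gtr0_norm h0).
  rewrite mulrDl mul1r (le_trans (ler_normB _ _))// lerD//.
    apply: le_sqrt_of_sqr; apply: (le_trans (integ_sq ab' (lY i))).
    by rewrite ler_wpM2l// ltW.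
  have l1 : L1 a b (fun t => Y t i 0 - Y a i 0).
    by apply: L1B; [exact: L2_L1|exact: L1_cst].
  rewrite (le_trans (integ_norm l1))// mulrC -integ_cst//; apply: integ_le.
  - exact: L1_norm.
  - exact: L1_cst.
  - by move=> y aby; exact: YA.
have PiS0 : 0 <= Pi * S by rewrite mulr_ge0.
have PE1 i := picard_error ab' S0 PiS0 lf HY' P0 PD Pa YA fB i (leqnn r) abt.
set c := damping r g in PE *.
have c0 : 0 <= c by exact: damping_ge0.
have cr : c <= r.+1%:R by exact: damping_le.
set v := amp D r c (t - a) (Y a - Yn) in PE *.
have -> : Y t - vpeval Ytr t = v + (Y t - vpeval (P r) t -
    (c / r.+1`!%:R * (t - a) ^+ r.+1) *: mpow D (Y a) r.+1).
  by rewrite PE; apply/colP => i; rewrite !mxE; ring.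
rewrite (le_trans (enormD _ _))// lerD2l (le_trans (enorm_le_sum _))//.
set K := S * _.
have -> : M%:R * K = \sum_(i < M) K by rewrite sumr_const card_ord mulr_natl.
apply: ler_sum => i _.
have fr : r`!%:R != 0 :> R by rewrite pnatr_eq0 -lt0n fact_gt0.
have fr0 : 0 < r`!%:R :> R by rewrite ltr0n fact_gt0.
case/andP: (abt) => at_ tb.
have ta0 : 0 <= t - a by rewrite subr_ge0.
have tah : t - a <= h by rewrite lerD2r.
have T1 : `|Y t i 0 - (P r i).[t]| <= S * (x ^+ r / r`!%:R + expR x * Pi).
  apply: (le_trans (PE1 i)); rewrite horner_expoly big_ord_recr/= eqxx addrC.
  rewrite mulrDr lerD//.
    rewrite -mulrA -mulrA ler_wpM2l// mulrCA mulrC ler_wpM2r ?invr_ge0 ?(ltW fr0)//.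
    by rewrite exprMn ler_wpM2l ?exprn_ge0// lerXn2r ?nnegrE// ltW.
  rewrite [leRHS](_ : _ = Pi * S * expR x); last by ring.
  apply: le_trans (ler_wpM2l PiS0 (sum_exp_coeff_le r x0)).
  rewrite mulr_sumr; apply: ler_sum => k _; rewrite ltn_eqF//.
  rewrite -!mulrA ler_wpM2l// ler_wpM2l// mulrCA mulrC.
  rewrite ler_wpM2r ?invr_ge0// exprMn ler_wpM2l ?exprn_ge0//.
  by rewrite lerXn2r ?nnegrE// ltW.
have T2 : `|c / r.+1`!%:R * (t - a) ^+ r.+1 * mpow D (Y a) r.+1 i 0| <=
    S * (x ^+ r / r`!%:R * (d + x)).
  have hS : 0 <= (1 + h) / h * S.
    by apply: mulr_ge0 => //; apply: divr_ge0; lra.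
  have cf : 0 <= c / r.+1`!%:R by rewrite divr_ge0.
  rewrite normrM ger0_norm; last by rewrite mulr_ge0// exprn_ge0.
  (* [c <= r + 1] turns [(r + 1)!] into [r!], and [(d h)^(r+1) (1 + h) / h = x^r (d + x)]. *)
  apply: (@le_trans _ _ (r`!%:R^-1 * h ^+ r.+1 * (d ^+ r.+1 * ((1 + h) / h * S)))).
    apply: ler_pM => //; first by rewrite mulr_ge0// exprn_ge0.
      apply: ler_pM; rewrite ?exprn_ge0//.
        rewrite ler_pdivrMr ?ltr0n ?fact_gt0// factS natrM mulrCA mulVf//.
        by rewrite mulr1.
      by rewrite lerXn2r ?nnegrE// ltW.
    exact: mpow_le.
  rewrite le_eqVlt; apply/orP; left; apply/eqP.
  by rewrite /x exprMn !exprS; field; rewrite fr gt_eqF.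
move: (mpow D (Y a) r.+1) T2 => z T2; rewrite !mxE.
rewrite (le_trans (ler_normB _ _))// (le_trans (lerD T1 T2))//.
by rewrite /K -mulrDr le_eqVlt; apply/orP; left; apply/eqP; congr (_ * _); ring.
Qed.

End LocalError.

(** * Derivative chains of Sobolev functions *)

Section Regularity.
Context {R : realType} {M : nat}.
Implicit Types (T : R) (f g : R -> R).

(** Reconciles the pointwise derivative of the differential equation with the one in the chain.
    Continuity of [g] will come from the second derivative of [Y], available because [l >= 1]. *)
Lemma AC_derive T f g s v : AC 0 T f g -> {within Icc 0 T, continuous g} ->
  0 < s < T -> is_derive s (1 : R) f v -> v = g s.
Proof.
move=> [lg fE] cg /andP[s0 sT] dv; have T0 := lt_trans s0 sT.
have [cg' _ _] := (continuous_within_itvP g T0).1 cg.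
have sI : s \in `]0, T[ by rewrite in_itv/= s0.
have [dF F's] := @continuous_FTC1_closed R g 0 s T sT (L2_L1 lg) s0 (cg' s sI).
have d1 : is_derive s (1 : R) (fun x => integ 0 x g) (g s).
  by apply: (DeriveDef dF); rewrite -derive1E; exact: F's.
have d2 : is_derive s (1 : R) f (0 + g s).
  apply: (@near_eq_is_derive _ _ _ (cst (f 0) + (fun x => integ 0 x g))).
  near=> x; apply/esym/fE.
  have : x \in `]0, T[ by near: x; exact: near_in_itvoo.
  by rewrite in_itv/= => /andP[/ltW -> /ltW ->].
by case: dv => _ <-; case: d2 => _ ->; rewrite add0r.
Unshelve. all: by end_near. Qed.

(** Descends from the top of the chain, the only level where square-integrability is assumed: each
    lower level is a primitive, hence continuous. *)
Lemma Hchain_L2 k T (F : R -> 'cV[R]_M) G j i : 0 <= T -> Hchain k T F G ->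
  (j <= k)%N -> L2 0 T (fun t => G j t i 0).
Proof.
move=> T0 [_ [Gint GL2]] jk.
rewrite -(subKn jk); elim: (k - j)%N => [|n IH].
  rewrite subn0; have [mG fG] := GL2 i; split => //.
  apply/integrableP; split.
    by apply/measurable_EFinP; exact: measurable_funX.
  move: fG; congr (_ < _)%E; apply: eq_integral => x _ /=.
  by rewrite ger0_norm// sqr_ge0.
have [kn|nk] := leqP k n.
  move: IH; rewrite (_ : k - n = 0)%N; last by apply/eqP; rewrite subn_eq0.
  by rewrite (_ : k - n.+1 = 0)%N//; apply/eqP; rewrite subn_eq0 ltnW.
have e : (k - n = (k - n.+1).+1)%N by rewrite -subSn// subSS.
have mk : (k - n.+1 < k)%N by rewrite -e leq_subr.
rewrite e in IH; have [_ GE] := Gint _ i mk.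
apply: (AC_L2 T0 (f := fun t => G (k - n.+1)%N t i 0)
  (g := fun t => G (k - n.+1).+1%N t i 0)).
by split => // t tT; exact: GE.
Qed.

Lemma Hchain_AC k T (F : R -> 'cV[R]_M) G j i : 0 <= T -> Hchain k T F G ->
  (j < k)%N -> AC 0 T (fun t => G j t i 0) (fun t => G j.+1 t i 0).
Proof.
move=> T0 H jk; split; first exact: Hchain_L2 T0 H jk.
by have [_ [Gint _]] := H; have [_ GE] := Gint _ i jk.
Qed.

Lemma L1_sqr_enorm T (G : R -> 'cV[R]_M) :
  (forall i, L2 0 T (fun t => G t i 0)) -> L1 0 T (fun t => enorm (G t) ^+ 2).
Proof.
move=> lG; apply: (@L1_eq _ _ _ (fun t => \sum_i G t i 0 ^+ 2)).
  by move=> t _; rewrite sqr_enorm; apply: eq_bigr => i _; rewrite expr2.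
by apply: L1_sum => i; exact: (lG i).2.
Qed.

Lemma Hnorm_ge0 k T (G : nat -> R -> 'cV[R]_M) : 0 <= Hnorm k T G.
Proof. exact: sqrtr_ge0. Qed.

Lemma sqr_Hnorm k T (G : nat -> R -> 'cV[R]_M) :
  Hnorm k T G ^+ 2 = \sum_(j < k.+1) integ 0 T (fun t => enorm (G j t) ^+ 2).
Proof.
rewrite /Hnorm sqr_sqrtr//; apply: sumr_ge0 => j _.
by rewrite -/(Rintegral _ _ _); apply: integ_ge0 => t _; exact: sqr_ge0.
Qed.

End Regularity.

(** * Rates uniform in the degree *)

Section Rates.
Context {R : realType}.
Implicit Types (d h kap tau : R).

Definition picard_const l d kap : R :=
  (1 + d) ^+ l * (l`!%:R * expR ((1 + kap) * expR 1)).

(** Of the [r] factors [d h], [min(r, l)] supply the power of [tau] and the others are at most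
    [1 + kap]. Since [r^l <= l! e^r], what remains is at most [l!] times a term of the series of
    [exp ((1 + kap) e)], so the constant is free of [r]. *)
Lemma picard_rate l r d h kap tau : (0 < r)%N -> 0 <= d -> 0 <= h -> h <= tau ->
  d * h <= kap ->
  (d * h) ^+ r / r`!%:R <=
    picard_const l d kap * (tau ^+ minn r l / r%:R ^+ l).
Proof.
move=> r0 d0 h0 ht xk; set s := minn r l; set x := d * h in xk *.
have x0 : 0 <= x by rewrite mulr_ge0.
have k0 : 0 <= kap by exact: le_trans xk.
have tau0 : 0 <= tau by exact: le_trans ht.
have lf : 0 < l`!%:R :> R by rewrite ltr0n fact_gt0.
have rf : 0 < r`!%:R :> R by rewrite ltr0n fact_gt0.
have rl0 : 0 < r%:R ^+ l :> R by rewrite exprn_gt0// ltr0n.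
have xr : x ^+ r <= (1 + d) ^+ l * tau ^+ s * (1 + kap) ^+ r.
  rewrite -(subnKC (geq_minl r l)) -/s exprD {1}/x exprMn.
  have d1 : 1 <= 1 + d by rewrite lerDl.
  have k1 : 1 <= 1 + kap by rewrite lerDl.
  apply: ler_pM; rewrite ?mulr_ge0 ?exprn_ge0//.
    apply: ler_pM; rewrite ?exprn_ge0//.
      apply: (@le_trans _ _ ((1 + d) ^+ s)).
        by rewrite lerXn2r ?nnegrE ?lerDr// ltW// (lt_le_trans ltr01).
      by rewrite ler_weXn2l// geq_minr.
    by rewrite lerXn2r ?nnegrE.
  rewrite subnKC ?geq_minl//.
  apply: (@le_trans _ _ ((1 + kap) ^+ (r - s))).
    rewrite lerXn2r ?nnegrE//; first exact: le_trans k1.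
    by rewrite (le_trans xk)// lerDr.
  by rewrite ler_weXn2l// leq_subr.
have rl : r%:R ^+ l <= l`!%:R * expR 1 ^+ r :> R.
  rewrite mulrC -ler_pdivrMr// -expRM_natl mulr1.
  exact: exprn_fact_le.
have K1 : (1 + kap) ^+ r * r%:R ^+ l / r`!%:R <=
    l`!%:R * expR ((1 + kap) * expR 1).
  have k1 : 0 <= 1 + kap by rewrite addr_ge0.
  apply: (@le_trans _ _ (l`!%:R * (((1 + kap) * expR 1) ^+ r / r`!%:R))).
    rewrite mulrA ler_wpM2r ?invr_ge0 ?(ltW rf)// exprMn mulrCA.
    by rewrite ler_wpM2l ?exprn_ge0.
  rewrite ler_wpM2l ?(ltW lf)// exprn_fact_le// mulr_ge0// expR_ge0.
rewrite /picard_const.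
apply: (@le_trans _ _ ((1 + d) ^+ l * tau ^+ s * (1 + kap) ^+ r / r`!%:R)).
  by rewrite ler_wpM2r ?invr_ge0 ?(ltW rf).
rewrite (_ : _ / _ = (1 + d) ^+ l * (tau ^+ s / r%:R ^+ l) *
   ((1 + kap) ^+ r * r%:R ^+ l / r`!%:R)); last by field; rewrite !gt_eqF.
rewrite [leRHS](_ : _ = (1 + d) ^+ l * (tau ^+ s / r%:R ^+ l) *
  (l`!%:R * expR ((1 + kap) * expR 1))); last by ring.
rewrite ler_wpM2l// mulr_ge0 ?exprn_ge0 ?addr_ge0// divr_ge0 ?exprn_ge0//.
Qed.

(** For [i < min(r, l)] one has [r <= l (r - i)], so every factor is at most [tau l / r]. If
    [r < l], the missing factors [l / r] exceed [1] and may be added. *)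
Lemma proj_rate l r (a b tau : R) : (0 < r)%N -> a <= b -> b - a <= tau ->
  proj_const a b r (minn r l) <= l%:R ^+ l * (tau ^+ minn r l / r%:R ^+ l).
Proof.
move=> r0 ab bt; set s := minn r l.
have ba0 : 0 <= b - a by rewrite subr_ge0.
have r0' : 0 < r%:R :> R by rewrite ltr0n.
have tau0 : 0 <= tau by exact: le_trans bt.
have sr : (s <= r)%N := geq_minl r l.
have sl : (s <= l)%N := geq_minr r l.
apply: (@le_trans _ _ (\prod_(i < s) (tau * (l%:R / r%:R)))).
  apply: ler_prod => i _; rewrite divr_ge0//=; apply: ler_pM => //.
  have ir : (i < r)%N by exact: leq_trans (ltn_ord i) sr.
  have ri0 : 0 < (r - i)%:R :> R by rewrite ltr0n subn_gt0.
  rewrite -[leLHS]mul1r ler_pdivlMr// mulrAC ler_pdivrMr// mul1r -natrM ler_nat.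
  have is_ := ltn_ord i; move: (nat_of_ord i) is_ ir => j js jr.
  clear -js jr sr sl; nia.
rewrite prodr_const card_ord exprMn mulrCA ler_wpM2l ?exprn_ge0//.
rewrite expr_div_n ler_pdivrMr ?exprn_gt0// mulrAC ler_pdivlMr ?exprn_gt0//.
rewrite -!natrX -!natrM ler_nat.
have [lr|rl] := leqP l r.
  by rewrite /s (minn_idPr lr).
rewrite /s (minn_idPl (ltnW rl)) -(subnKC (ltnW rl)) !expnD mulnCA mulnA.
rewrite subnKC ?(ltnW rl)// [leqRHS]mulnC mulnA leq_mul2l leq_exp2r ?subn_gt0//.
by rewrite (ltnW rl) orbT.
Qed.

(** Cauchy-Schwarz in the plane, in the form used to append one interval at a time. *)
Lemma sqrt_superadditive (A B x y : R) : 0 <= A -> 0 <= B -> 0 <= x -> 0 <= y ->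
  Num.sqrt (x * A) + Num.sqrt (y * B) <= Num.sqrt ((x + y) * (A + B)).
Proof.
move=> A0 B0 x0 y0.
rewrite !sqrtrM ?addr_ge0//.
rewrite -(ler_pXn2r (isT : (0 < 2)%N)) ?nnegrE ?addr_ge0 ?mulr_ge0 ?sqrtr_ge0//.
rewrite [leRHS]exprMn !sqr_sqrtr ?addr_ge0//.
have -> : (x + y) * (A + B) = (Num.sqrt x ^+ 2 + Num.sqrt y ^+ 2) *
    (Num.sqrt A ^+ 2 + Num.sqrt B ^+ 2) by rewrite !sqr_sqrtr.
rewrite -subr_ge0 (_ : _ - _ =
  (Num.sqrt x * Num.sqrt B - Num.sqrt y * Num.sqrt A) ^+ 2); last by ring.
exact: sqr_ge0.
Qed.

End Rates.

(** * The CFL condition as a bound uniform in the degree *)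

Section Operator.
Context {R : realType} {M : nat} (D : 'M[R]_M).

Lemma mxsum_eq0 : opnorm D = 0 -> mxsum D = 0.
Proof.
move=> D0; apply: big1 => i _; apply: big1 => j _; apply/eqP.
rewrite normr_eq0 -normr_le0.
have := enorm_mulmx D (delta_mx j 0 : 'cV[R]_M); rewrite D0 mul0r; apply: le_trans.
have -> : D i j = (D *m (delta_mx j 0 : 'cV[R]_M)) i 0.
  rewrite mxE (bigD1 j)//= big1 ?addr0 => [|k kj].
    by rewrite mxE !eqxx mulr1.
  by rewrite mxE (negbTE kj) mulr0.
exact: abs_le_enorm.
Qed.

Lemma lam_le3 r (g : R) : 0 < g < 1 -> (0 < r)%N -> lam r g <= 3.
Proof.
move=> g01 r0; have [g0 g1] := andP g01.
have l0 : 0 <= lam r g.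
  by rewrite /lam; do !case: ifP => _; exact: sqrtr_ge0.
suff : lam r g ^+ 2 <= 3 ^+ 2 by rewrite ler_pXn2r ?nnegrE.
have [h0 h1 h2 h3] := sqr_lam_le g01 r0 l0 (lexx _).
set y := lam r g ^+ 2 in h0 h1 h2 h3 *.
have y0 : 0 <= y by exact: sqr_ge0.
have gg : 0 <= g ^+ 2 by exact: sqr_ge0.
have := ltn_pmod r (isT : (0 < 4)%N).
case: (r %% 4)%N h0 h1 h2 h3 => [|[|[|[|//]]]] h0 h1 h2 h3 _.
- by have := h0 erefl; lra.
- have := h1 erefl; case: ifP => _ H; first by lra.
  have : y * 2 <= y * (3 - g) by rewrite ler_wpM2l//; lra.
  lra.
- have := h2 erefl; case: ifP => _ H; first by lra.
  have : y * 3 <= y * (4 - g) by rewrite ler_wpM2l//; lra.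
  lra.
- by have := h3 erefl; lra.
Qed.

(** The [3] is the uniform bound of [lam]. If [opnorm D = 0], the inverse is [0] by convention, and
    [mxsum D] vanishes as well. *)
Definition cfl_const : R := mxsum D * (3 / opnorm D).

Lemma mxsum_cfl r g h : 0 < g < 1 -> (0 < r)%N -> 0 <= h ->
  h * opnorm D <= lam r g -> mxsum D * h <= cfl_const.
Proof.
move=> g01 r0 h0 hl; rewrite /cfl_const.
have [D0|D0] := eqVneq (opnorm D) 0; first by rewrite mxsum_eq0// !mul0r.
rewrite ler_wpM2l ?mxsum_ge0// ler_pdivlMr.
  exact: le_trans (lam_le3 g01 r0).
by rewrite lt_neqAle eq_sym D0 opnorm_ge0.
Qed.

End Operator.

(** * Locating a time in the partition *)

Section Partition.
Context {R : realType}.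
Variables (N : nat) (t : nat -> R).
(** The first alternative covers [N = 0], when there is no interval. *)
Lemma partition_find s : t 0%N <= s <= t N ->
  s = t 0%N \/ exists2 n, (n < N)%N & t n <= s <= t n.+1.
Proof.
move=> /andP[s0 sN].
suff H m : (m <= N)%N -> s <= t m ->
    s = t 0%N \/ exists2 n, (n < N)%N & t n <= s <= t n.+1.
  exact: H (leqnn N) sN.
elim: m => [|n IH] nN sn; first by left; apply/eqP; rewrite eq_le sn s0.
have [sn'|sn'] := leP s (t n); first exact: IH (ltnW nN) sn'.
by right; exists n => //; rewrite (ltW sn') sn.
Qed.

Lemma partition_step n : (n < N)%N ->
  t n.+1 - t n <= \big[Num.max/0]_(i < N) (t i.+1 - t i).
Proof.
by move=> nN; exact: (le_bigmax _ (fun i : 'I_N => t i.+1 - t i) (Ordinal nN)).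
Qed.

Hypothesis tS : forall n, (n < N)%N -> t n < t n.+1.

Lemma partition_le m n : (m <= n <= N)%N -> t m <= t n.
Proof.
move=> /andP[]; elim: n => [|n IH]; first by rewrite leqn0 => /eqP->.
rewrite leq_eqVlt => /orP[/eqP->//|mn nN].
by rewrite (le_trans (IH mn (ltnW nN)))// ltW// tS.
Qed.

End Partition.

(** * Accumulation of the local errors *)

Theorem theorem3p2 (R : realType) (M : nat) (D : 'M[R]_M) (g : R) (l : nat) :
  D + D^T = 0 -> 0 < g < 1 -> (1 <= l)%N ->
  exists C : R,
  forall (T : R) (N : nat) (t : nat -> R) (r : nat)
         (Rf : R -> 'cV[R]_M) (GR : nat -> R -> 'cV[R]_M)
         (Y : R -> 'cV[R]_M) (GY : nat -> R -> 'cV[R]_M)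
         (Y0 : 'cV[R]_M) (Ytil : R -> 'cV[R]_M),
    (1 <= r)%N ->
    t 0%N = 0 -> t N = T -> (forall n, (n < N)%N -> t n < t n.+1) ->
    let tau := \big[Num.max/0]_(n < N) (t n.+1 - t n) in
    tau * opnorm D <= lam r g ->
    Hchain l T Rf GR ->
    Hchain l.+1 T Y GY ->
    Y 0 = Y0 ->
    (forall s, 0 < s < T -> forall i : 'I_M,
        is_derive s (1 : R) (fun u => Y u i 0) ((D *m Y s + Rf s) i 0)) ->
    scheme_output D r g Rf N t Y0 Ytil ->
    forall s, 0 <= s <= T ->
      enorm (Y s - Ytil s) <=
        C * Num.sqrt T * (tau ^+ minn r l / r%:R ^+ l) *
        (Hnorm l.+1 T GY + Hnorm l T GR).
Proof.
move=> Dskew g01 l1; have [g0 g1] := andP g01.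
set d := mxsum D; set kap := cfl_const D.
have d0 : 0 <= d := mxsum_ge0 D.
pose P1 := picard_const l d kap; pose P2 := expR kap * l%:R ^+ l.
(* [P1] serves the Picard and correction terms, whose factor [1 + d + x] is bounded through
   [x <= kap]; [P2] serves the projection term, and [M] comes from summing components. *)
exists (M%:R * (P1 * (1 + d + kap) + P2)).
move=> T N t r Rf GR Y GY Y0 Ytil r0 t0 tN tS tau cfl HR HY Y00 Yode [Yt0 Hsch] s sT.
have T0 : 0 <= T by case/andP: sT => h1 h2; exact: le_trans h2.
pose k := minn r l.
have k0 : (0 < k)%N by rewrite leq_min r0 l1.
have kl : (k <= l)%N := geq_minr r l.
have kr : (k <= r)%N := geq_minl r l.
have YG u : 0 <= u <= T -> GY 0%N u = Y u by case: HY => + _; exact.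
have RG u : 0 <= u <= T -> GR 0%N u = Rf u by case: HR => + _; exact.
have tau0 : 0 <= tau by exact: bigmax_ge_id.
pose rate := tau ^+ k / r%:R ^+ l.
have rate0 : 0 <= rate by rewrite divr_ge0 ?exprn_ge0.
(* A single density dominating the three quantities that [local_error] measures; its integral is
   additive over the steps. *)
pose w u := enorm (GY 0%N u) ^+ 2 + enorm (GY 1%N u) ^+ 2 + enorm (GR k u) ^+ 2.
have lGY j i : (j <= l.+1)%N -> L2 0 T (fun u => GY j u i 0).
  exact: Hchain_L2 T0 HY.
have lw1 := L1_sqr_enorm (fun i => lGY 0%N i isT).
have lw2 := L1_sqr_enorm (fun i => lGY 1%N i isT).
have lw3 := L1_sqr_enorm (fun i => Hchain_L2 i T0 HR kl).
have lw : L1 0 T w by apply: L1D => //; exact: L1D.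
have w0 u : 0 <= w u by rewrite !addr_ge0 ?sqr_ge0.
have P10 : 0 <= P1.
  by rewrite mulr_ge0 ?exprn_ge0 ?addr_ge0// mulr_ge0// expR_ge0.
have kap0 : 0 <= kap by rewrite mulr_ge0// divr_ge0// opnorm_ge0.
pose K := M%:R * (P1 * (1 + d + kap) + P2).
have K0 : 0 <= K.
  rewrite mulr_ge0// addr_ge0//; first by rewrite mulr_ge0// !addr_ge0.
  by rewrite mulr_ge0 ?expR_ge0// exprn_ge0.
pose err u := enorm (Y u - Ytil u).
have tT n : (n <= N)%N -> 0 <= t n <= T.
  move=> nN; apply/andP; split.
    by rewrite -[leLHS]t0; apply: (partition_le tS); rewrite nN.
  by rewrite -tN; apply: (partition_le tS); rewrite nN leqnn.
have step n u : (n < N)%N -> t n <= u <= t n.+1 -> err u <=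
    err (t n) + K * rate * Num.sqrt ((t n.+1 - t n) * integ (t n) (t n.+1) w).
  move=> nN nu; have [Ytr [Hstep YtrE]] := Hsch n nN.
  have /andP[tn0 _] := tT n (ltnW nN); have /andP[_ tnT] := tT n.+1 nN.
  have tlt := tS n nN.
  have wW (G : R -> 'cV[R]_M) i : L1 0 T (fun u => enorm (G u) ^+ 2) ->
      L2 0 T (fun u => G u i 0) -> (forall u, enorm (G u) ^+ 2 <= w u) ->
      integ (t n) (t n.+1) (fun u => G u i 0 ^+ 2) <= integ (t n) (t n.+1) w.
    move=> lG lGi Gw; apply: integ_le.
    - exact: L1_sub lGi.2.
    - exact: L1_sub lw.
    - move=> y _; apply: le_trans (Gw y).
      rewrite -real_normK ?num_real// lerXn2r ?nnegrE ?enorm_ge0//.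
      exact: abs_le_enorm.
  have ACs (f h : R -> R) : AC 0 T f h -> AC (t n) (t n.+1) f h.
    by apply: AC_sub => //; exact: ltW.
  have inT y : t n <= y <= t n.+1 -> 0 <= y <= T.
    by move=> /andP[h1 h2]; rewrite (le_trans tn0 h1) (le_trans h2 tnT).
  have YAC i : AC 0 T (fun u => Y u i 0) (fun u => GY 1%N u i 0).
    have [lg GE] := Hchain_AC i T0 HY (ltn0Sn l); split => // y yT.
    have T00 : 0 <= (0 : R) <= T by rewrite lexx.
    by rewrite -(YG y yT) -(YG 0 T00); exact: GE.
  have := @local_error _ _ D (t n) (t n.+1) r k g Y Rf (GY 1%N) GR
    (Ytil (t n)) Ytr (integ (t n) (t n.+1) w) tlt g0 r0.
  rewrite k0 kr => /(_ isT Hstep) loc.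
  have {}loc := loc (fun i => ACs _ _ (YAC i)).
  have h0 : 0 <= t n.+1 - t n by rewrite subr_ge0 ltW.
  have htau : t n.+1 - t n <= tau := partition_step t nN.
  have hl : (t n.+1 - t n) * opnorm D <= lam r g.
    by apply: le_trans cfl; rewrite ler_wpM2r// opnorm_ge0.
  set x := d * (t n.+1 - t n).
  have x0 : 0 <= x by rewrite mulr_ge0.
  have xk : x <= kap := mxsum_cfl g01 r0 h0 hl.
  rewrite /err (YtrE u nu).
  apply: (le_trans (loc _ _ _ _ _ _ u nu)).
  - move=> i y /andP[ny yn].
    have yT : 0 < y < T by rewrite (le_lt_trans tn0 ny) (lt_le_trans yn tnT).
    apply/esym/(AC_derive (YAC i) _ yT); last exact: Yode.
    apply: AC_continuous T0 (Hchain_AC i T0 HY _).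
    by rewrite ltnS.
  - by move=> y yn; rewrite RG// inT.
  - by move=> i j jk; apply: ACs; apply: Hchain_AC T0 HR _; exact: leq_trans kl.
  - move=> i; rewrite (@integ_eq _ _ _ _ (fun u => GY 0%N u i 0 ^+ 2)).
      apply: wW => //; first exact: lGY.
      by move=> y; rewrite /w -addrA lerDl addr_ge0 ?sqr_ge0.
    by move=> y yn; rewrite YG// inT.
  - move=> i; apply: wW => //; first exact: lGY.
    by move=> y; rewrite /w addrAC lerDr addr_ge0 ?sqr_ge0.
  - move=> i; apply: wW => //; first exact: Hchain_L2 T0 HR kl.
    by move=> y; rewrite /w lerDr addr_ge0 ?sqr_ge0.
  rewrite -/d -/x; apply: lerD.
    apply: (amp_stable Dskew _ g01 r0 _ (opnorm_ge0 D)) => //.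
    - by case/andP: nu => ? _; rewrite subr_ge0.
    - exact: enorm_mulmx.
    - apply: le_trans hl; rewrite ler_wpM2r ?opnorm_ge0// lerD2r.
      by case/andP: nu.
  set S := Num.sqrt _.
  have -> : K * rate * S = M%:R * (S * ((P1 * (1 + d + kap) + P2) * rate)).
    by rewrite /K; ring.
  rewrite ler_wpM2l// ler_wpM2l ?sqrtr_ge0//.
  have h1 : x ^+ r / r`!%:R <= P1 * rate := picard_rate l r0 d0 h0 htau xk.
  have h2 : proj_const (t n) (t n.+1) r k <= l%:R ^+ l * rate.
    exact: (proj_rate l r0 (ltW tlt) htau).
  rewrite mulrDl; apply: lerD.
    rewrite [leRHS]mulrAC; apply: ler_pM => //; rewrite ?addr_ge0//.
      by rewrite divr_ge0// exprn_ge0.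
    by rewrite lerD2l.
  rewrite /P2 -mulrA; apply: ler_pM => //.
  - by apply: prodr_ge0 => i _; rewrite divr_ge0.
  - by rewrite ler_expR.
pose Q := K * rate.
have Q0 : 0 <= Q by rewrite mulr_ge0.
have err0 : err 0 = 0.
  by rewrite /err Y00 Yt0 subrr -(scale0r 0) enormZ normr0 mul0r.
have integw a b : 0 <= integ a b w by apply: integ_ge0.
(* Keeping the elapsed time inside the root lets [sqrt_superadditive] absorb the new step. *)
have next n u : (n < N)%N -> t n <= u <= t n.+1 ->
    err (t n) <= Q * Num.sqrt (t n * integ 0 (t n) w) ->
    err u <= Q * Num.sqrt (t n.+1 * integ 0 (t n.+1) w).
  move=> nN nu IH; apply: (le_trans (step n u nN nu)).
  have /andP[tn0 _] := tT n (ltnW nN); have /andP[_ tnT] := tT n.+1 nN.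
  have tlt := ltW (tS n nN).
  apply: (le_trans (lerD IH (lexx _))); rewrite -/Q -mulrDr ler_wpM2l//.
  have := @sqrt_superadditive _ (integ 0 (t n) w) (integ (t n) (t n.+1) w)
    (t n) (t n.+1 - t n).
  rewrite -integ_cat//; last exact: L1_sub lw.
  by rewrite [t n + _]addrC subrK; apply => //; rewrite subr_ge0.
have nodes n : (n <= N)%N -> err (t n) <= Q * Num.sqrt (t n * integ 0 (t n) w).
  elim: n => [_|n IH nN]; first by rewrite t0 err0 mulr_ge0// sqrtr_ge0.
  by apply: (next n _ nN); [rewrite lexx ltW ?tS|exact: IH (ltnW nN)].
have errT u : 0 <= u <= T -> err u <= Q * Num.sqrt (T * integ 0 T w).
  rewrite -{1}t0 -{1}tN => /partition_find[->|[n nN nu]].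
    by rewrite t0 err0 mulr_ge0// sqrtr_ge0.
  apply: (le_trans (next n u nN nu (nodes n (ltnW nN)))); rewrite ler_wpM2l//.
  have /andP[tn0 tnT] := tT n.+1 nN.
  apply: ler_wsqrtr; apply: ler_pM => //.
  by apply: integ_sub_le.
apply: (le_trans (errT s sT)).
rewrite sqrtrM// -/rate -/K.
rewrite [leRHS](_ : _ = Q * (Num.sqrt T * (Hnorm l.+1 T GY + Hnorm l T GR))); last first.
  by rewrite /Q; ring.
rewrite ler_wpM2l// ler_wpM2l ?sqrtr_ge0//.
have HY0 := Hnorm_ge0 l.+1 T GY; have HR0 := Hnorm_ge0 l T GR.
rewrite -[leRHS]ger0_norm ?addr_ge0// -sqrtr_sqr; apply: ler_wsqrtr.
apply: (@le_trans _ _ (Hnorm l.+1 T GY ^+ 2 + Hnorm l T GR ^+ 2)); last first.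
  by rewrite sqrrD lerD2r lerDl mulrn_wge0// mulr_ge0.
(* The density uses the terms [0] and [1] of the norm of [Y] and the term [k <= l] of the norm of
   the data. *)
rewrite !sqr_Hnorm /w integD//; last exact: L1D.
rewrite integD//; apply: lerD.
  rewrite !big_ord_recl /= addrA lerDl sumr_ge0// => j _.
  by apply: integ_ge0 => u _; exact: sqr_ge0.
have kl' : (k < l.+1)%N by [].
rewrite (bigD1 (Ordinal kl'))//= lerDl sumr_ge0// => j _.
by apply: integ_ge0 => u _; exact: sqr_ge0.
Qed.
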